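(* For every sequent $\mathcal S$: there exists a $\mathbf P$-schema $\Psi$ (for some set $\mathbf P$ of passive parameters) with end-sequent $\mathcal S$ if and only if there exists an $\mathit{mv}\mathbf{LKIE}$-derivation of $\mathcal S$.
   Context: Language. Two sorts: $\omega$ (with $0$, successor $s$) and $\iota$; formulas built with $\neg,\wedge,\vee,\to,\forall,\exists$. Numeric terms are built from $0$, $s$ and three disjoint sets of parameters: active ($n$; $n'=s(n)$), passive, internal ($\mathbf m,\mathbf a,\dots$). Active and internal parameters may not be quantified. Defined symbols $\hat f$ are given by a convergent set $\mathcal E$ of primitive recursive rewrite rules. $\mathcal V_a(S),\mathcal V_p(S),\mathcal V_i(S)$ are the active, passive, internal parameters of a sequent $S$; an $(n,\mathcal I)$-sequent has active parameters exactly $\{n\}$ and internal parameters $\mathcal I$. Calculi. $\mathit{mv}\mathbf{LKE}$ is $\mathbf{LK}$ over this language plus the rule: from $S(t)$ infer $S(t')$ when $\mathcal E\models t=t'$. $\mathit{mv}\mathbf{LKS}$ additionally allows proof links as leaves (premise-free inferences labelled $(\varphi,\bar a)$, $\varphi$ a proof symbol, with conclusion $S(\bar a)$). $\mathit{mv}\mathbf{LKIE}$ is $\mathit{mv}\mathbf{LKE}$ plus the induction rule: from $F(n,\mathbf m_1,\dots,\mathbf m_\gamma),\Gamma\vdash\Delta,F(n',\mathbf m_1,\dots,\mathbf m_\gamma)$ infer $F(0,\mathbf a_1,\dots,\mathbf a_\gamma),\Gamma\vdash\Delta,F(t,\mathbf a_1,\dots,\mathbf a_\gamma)$, where $n$ is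 an active parameter, the $\mathbf m_i$ internal parameters, $t$ and $\mathbf a_i$ arbitrary numeric terms, with at most one active parameter per sequent; passive parameters may be quantified (strong quantifier rules) as eigenvariables. Components and $\mathbf P$-schemata. An $(n,\mathcal I)$-component is a triple $\mathbf C=(\psi,\pi,\nu)$ with $\nu$ an $\mathit{mv}\mathbf{LKS}$-derivation whose only active parameter is $n$, ending in an $(n,\mathcal I)$-sequent $S=es(\mathbf C)$, and $\pi$ an $\mathit{mv}\mathbf{LKS}$-derivation without active parameters ending in $S\{n\leftarrow0\}$; links labelled $\psi$ are links to $\mathbf C$. For distinct components, $\mathbf C\prec\mathbf D$ if every sequent of $\mathbf C$ concluding a link to $\mathbf D$ contains all passive parameters of $es(\mathbf D)$. A $\mathbf P$-schema is a sequence $\Psi=\langle\mathbf C_1,\dots,\mathbf C_\alpha\rangle$ of components with distinct proof symbols, passive parameters in $\mathbf P$, $\mathbf C_1$ an $(n,\mathcal I)$-component, with a well-founded suborder of $\prec$ with least element $\mathbf C_1$ along which links between distinct components go; $es(\Psi)=es(\mathbf C_1)$. (Sub-$\mathbf P$-schemata, possibly computational, i.e. linked with non-ground instantiations of their active parameter, are allowed.)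
   Formalization: S is restricted to sequents with exactly one active parameter n (closed derivable sequents such as P ⊢ P have no schema); in a component ν ends in S{n←n'} and links to the component itself occur only in ν and instantiate n by n, since unrestricted self-links are circular. *)

(* Defs.v *)
From Stdlib Require Import List Arith Bool PeanoNat Relations Permutation.
Import ListNotations.

Inductive sort := SOm (* omega: numeric sort *) | SIo (* iota *).

Definition sort_eqb (a b : sort) : bool :=
  match a, b with SOm, SOm | SIo, SIo => true | _, _ => false end.

Inductive pkind := Active | Passive | Internal.

Inductive fname := NPar (k : pkind) (i : nat) | NVar (i : nat).

Definition fname_eq_dec (a b : fname) : {a = b} + {a <> b}.
Proof. decide equality; [apply Nat.eq_dec | decide equality | apply Nat.eq_dec]. Defined.

Definition fsort (a : fname) : sort :=
  match a with NPar _ _ => SOm | NVar _ => SIo end.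

(* Terms (locally nameless: bound variables are de Bruijn indices).
   TFun: uninterpreted function symbols; TDef: defined symbols (\hat f),
   whose meaning is given by the rewrite system E. *)
Inductive term :=
| TZero
| TSucc (t : term)
| TFree (a : fname)
| TBVar (i : nat)
| TFun (f : nat) (args : list term)
| TDef (f : nat) (args : list term).

Record signature := {
  fun_ar  : nat -> list sort * sort;
  def_ar  : nat -> list sort * sort;
  pred_ar : nat -> list sort
}.

Fixpoint args_ok (l : list (option sort)) (ss : list sort) : bool :=
  match l, ss with
  | [], [] => true
  | Some s :: l', s' :: ss' => sort_eqb s s' && args_ok l' ss'
  | _, _ => false
  end.

Fixpoint tsort (sg : signature) (G : list sort) (t : term) : option sort :=
  match t with
  | TZero => Some SOm
  | TSucc u => match tsort sg G u with Some SOm => Some SOm | _ => None end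
  | TFree a => Some (fsort a)
  | TBVar i => nth_error G i
  | TFun f l =>
      if args_ok (map (tsort sg G) l) (fst (fun_ar sg f))
      then Some (snd (fun_ar sg f)) else None
  | TDef f l =>
      if args_ok (map (tsort sg G) l) (fst (def_ar sg f))
      then Some (snd (def_ar sg f)) else None
  end.

Fixpoint tsubst (s : fname -> term) (t : term) : term :=
  match t with
  | TZero => TZero
  | TSucc u => TSucc (tsubst s u)
  | TFree a => s a
  | TBVar i => TBVar i
  | TFun f l => TFun f (map (tsubst s) l)
  | TDef f l => TDef f (map (tsubst s) l)
  end.

Fixpoint tnames (t : term) : list fname :=
  match t with
  | TZero | TBVar _ => []
  | TSucc u => tnames u
  | TFree a => [a]
  | TFun _ l | TDef _ l => flat_map tnames l
  end.

(* replace bound index k by the (locally closed) term u *)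
Fixpoint topen (k : nat) (u : term) (t : term) : term :=
  match t with
  | TZero => TZero
  | TSucc v => TSucc (topen k u v)
  | TFree a => TFree a
  | TBVar i => if Nat.eqb i k then u else TBVar i
  | TFun f l => TFun f (map (topen k u) l)
  | TDef f l => TDef f (map (topen k u) l)
  end.

Inductive form :=
| FAtom (p : nat) (args : list term)
| FNeg (A : form)
| FAnd (A B : form)
| FOr (A B : form)
| FImp (A B : form)
| FAll (s : sort) (A : form)   (* binds de Bruijn index 0, of sort s *)
| FEx (s : sort) (A : form).

Fixpoint wf_form (sg : signature) (G : list sort) (A : form) : Prop :=
  match A with
  | FAtom p l => args_ok (map (tsort sg G) l) (pred_ar sg p) = true
  | FNeg B => wf_form sg G B
  | FAnd B C | FOr B C | FImp B C => wf_form sg G B /\ wf_form sg G C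
  | FAll s B | FEx s B => wf_form sg (s :: G) B
  end.

Fixpoint fsubst (s : fname -> term) (A : form) : form :=
  match A with
  | FAtom p l => FAtom p (map (tsubst s) l)
  | FNeg B => FNeg (fsubst s B)
  | FAnd B C => FAnd (fsubst s B) (fsubst s C)
  | FOr B C => FOr (fsubst s B) (fsubst s C)
  | FImp B C => FImp (fsubst s B) (fsubst s C)
  | FAll so B => FAll so (fsubst s B)
  | FEx so B => FEx so (fsubst s B)
  end.

Fixpoint fnames (A : form) : list fname :=
  match A with
  | FAtom _ l => flat_map tnames l
  | FNeg B => fnames B
  | FAnd B C | FOr B C | FImp B C => fnames B ++ fnames C
  | FAll _ B | FEx _ B => fnames B
  end.

Fixpoint fopen (k : nat) (u : term) (A : form) : form :=
  match A with
  | FAtom p l => FAtom p (map (topen k u) l)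
  | FNeg B => FNeg (fopen k u B)
  | FAnd B C => FAnd (fopen k u B) (fopen k u C)
  | FOr B C => FOr (fopen k u B) (fopen k u C)
  | FImp B C => FImp (fopen k u B) (fopen k u C)
  | FAll so B => FAll so (fopen (S k) u B)
  | FEx so B => FEx so (fopen (S k) u B)
  end.

Definition inst (A : form) (u : term) : form := fopen 0 u A.

Record sequent := Seq { ant : list form; suc : list form }.

Definition wf_seq (sg : signature) (S : sequent) : Prop :=
  Forall (wf_form sg []) (ant S) /\ Forall (wf_form sg []) (suc S).

Definition ssubst (s : fname -> term) (S : sequent) : sequent :=
  Seq (map (fsubst s) (ant S)) (map (fsubst s) (suc S)).

Definition snames (S : sequent) : list fname :=
  flat_map fnames (ant S) ++ flat_map fnames (suc S).

Definition lnames (l : list form) : list fname := flat_map fnames l.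

Definition active_params (S : sequent) : list nat :=
  flat_map (fun a => match a with NPar Active i => [i] | _ => [] end) (snames S).
Definition internal_params (S : sequent) : list nat :=
  flat_map (fun a => match a with NPar Internal i => [i] | _ => [] end) (snames S).
Definition passive_params (S : sequent) : list nat :=
  flat_map (fun a => match a with NPar Passive i => [i] | _ => [] end) (snames S).

Definition upd (a : fname) (u : term) : fname -> term :=
  fun b => if fname_eq_dec a b then u else TFree b.

Fixpoint assoc_nat (i : nat) (l : list (nat * term)) : option term :=
  match l with
  | [] => None
  | (j, u) :: l' => if Nat.eqb i j then Some u else assoc_nat i l'
  end.

Definition psub (n : nat) (t : term) (ms : list nat) (as_ : list term)
  : fname -> term :=
  fun b => match b with
           | NPar Active i => if Nat.eqb i n then t else TFree b
           | NPar Internal i =>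
               match assoc_nat i (combine ms as_) with
               | Some u => u | None => TFree b end
           | _ => TFree b
           end.

Definition rules := list (term * term).

Inductive eqE (E : rules) : term -> term -> Prop :=
| eqE_refl t : eqE E t t
| eqE_sym t u : eqE E t u -> eqE E u t
| eqE_trans t u v : eqE E t u -> eqE E u v -> eqE E t v
| eqE_succ t u : eqE E t u -> eqE E (TSucc t) (TSucc u)
| eqE_fun f l l' : Forall2 (eqE E) l l' -> eqE E (TFun f l) (TFun f l')
| eqE_def f l l' : Forall2 (eqE E) l l' -> eqE E (TDef f l) (TDef f l')
| eqE_rule l r s : In (l, r) E -> eqE E (tsubst s l) (tsubst s r).

Fixpoint feqE (E : rules) (A B : form) : Prop :=
  match A, B with
  | FAtom p l, FAtom q l' => p = q /\ Forall2 (eqE E) l l'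
  | FNeg A1, FNeg B1 => feqE E A1 B1
  | FAnd A1 A2, FAnd B1 B2 | FOr A1 A2, FOr B1 B2 | FImp A1 A2, FImp B1 B2 =>
      feqE E A1 B1 /\ feqE E A2 B2
  | FAll s A1, FAll s' B1 | FEx s A1, FEx s' B1 => s = s' /\ feqE E A1 B1
  | _, _ => False
  end.

Definition seqE (E : rules) (S S' : sequent) : Prop :=
  Forall2 (feqE E) (ant S) (ant S') /\ Forall2 (feqE E) (suc S) (suc S').

Inductive rew (E : rules) : term -> term -> Prop :=
| rew_top l r s : In (l, r) E -> rew E (tsubst s l) (tsubst s r)
| rew_succ t t' : rew E t t' -> rew E (TSucc t) (TSucc t')
| rew_fun f l1 t t' l2 : rew E t t' ->
    rew E (TFun f (l1 ++ t :: l2)) (TFun f (l1 ++ t' :: l2))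
| rew_def f l1 t t' l2 : rew E t t' ->
    rew E (TDef f (l1 ++ t :: l2)) (TDef f (l1 ++ t' :: l2)).

Definition convergent (E : rules) : Prop :=
  (forall t, Acc (fun u v => rew E v u) t) /\
  (forall t u v, clos_refl_trans _ (rew E) t u -> clos_refl_trans _ (rew E) t v ->
     exists w, clos_refl_trans _ (rew E) u w /\ clos_refl_trans _ (rew E) v w).

(* occurrences of defined symbols in a right-hand side of a rule for f:
   either symbols defined earlier (g < f) or the recursive call [rc] *)
Fixpoint calls_ok (f : nat) (rc : option term) (t : term) {struct t} : Prop :=
  match t with
  | TZero | TFree _ | TBVar _ => True
  | TSucc u => calls_ok f rc u
  | TFun _ l =>
      (fix go (l : list term) : Prop :=
         match l with [] => True | u :: l' => calls_ok f rc u /\ go l' end) l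
  | TDef g l =>
      Some t = rc \/
      (g < f /\
       (fix go (l : list term) : Prop :=
          match l with [] => True | u :: l' => calls_ok f rc u /\ go l' end) l)
  end.

Definition primrec_rule (lr : term * term) : Prop :=
  let (l, r) := lr in
  incl (tnames r) (tnames l) /\
  exists f m xs, NoDup (m :: xs) /\
    ( (l = TDef f (map TFree xs) /\ calls_ok f None r)
   \/ (l = TDef f (TZero :: map TFree xs) /\ calls_ok f None r)
   \/ (l = TDef f (TSucc (TFree m) :: map TFree xs) /\
       calls_ok f (Some (TDef f (TFree m :: map TFree xs))) r)).

Definition primrec_system (E : rules) : Prop := Forall primrec_rule E.

Definition wf_rules (sg : signature) (E : rules) : Prop :=
  Forall (fun lr => exists s, tsort sg [] (fst lr) = Some s /\
                              tsort sg [] (snd lr) = Some s) E.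

Definition eigen_ok (s : sort) (a : fname) : Prop :=
  match s, a with
  | SIo, NVar _ => True
  | SOm, NPar Passive _ => True
  | _, _ => False
  end.

Inductive lkE_rule (sg : signature) (E : rules) : list sequent -> sequent -> Prop :=
| r_ax A : lkE_rule sg E [] (Seq [A] [A])
| r_exch G D G' D' : Permutation G G' -> Permutation D D' ->
    lkE_rule sg E [Seq G D] (Seq G' D')
| r_wl A G D : lkE_rule sg E [Seq G D] (Seq (A :: G) D)
| r_wr A G D : lkE_rule sg E [Seq G D] (Seq G (A :: D))
| r_cl A G D : lkE_rule sg E [Seq (A :: A :: G) D] (Seq (A :: G) D)
| r_cr A G D : lkE_rule sg E [Seq G (A :: A :: D)] (Seq G (A :: D))
| r_cut A G D G' D' :
    lkE_rule sg E [Seq G (A :: D); Seq (A :: G') D'] (Seq (G ++ G') (D ++ D'))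
| r_negl A G D : lkE_rule sg E [Seq G (A :: D)] (Seq (FNeg A :: G) D)
| r_negr A G D : lkE_rule sg E [Seq (A :: G) D] (Seq G (FNeg A :: D))
| r_andl1 A B G D : lkE_rule sg E [Seq (A :: G) D] (Seq (FAnd A B :: G) D)
| r_andl2 A B G D : lkE_rule sg E [Seq (B :: G) D] (Seq (FAnd A B :: G) D)
| r_andr A B G D :
    lkE_rule sg E [Seq G (A :: D); Seq G (B :: D)] (Seq G (FAnd A B :: D))
| r_orl A B G D :
    lkE_rule sg E [Seq (A :: G) D; Seq (B :: G) D] (Seq (FOr A B :: G) D)
| r_orr1 A B G D : lkE_rule sg E [Seq G (A :: D)] (Seq G (FOr A B :: D))
| r_orr2 A B G D : lkE_rule sg E [Seq G (B :: D)] (Seq G (FOr A B :: D))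
| r_impl A B G D G' D' :
    lkE_rule sg E [Seq G (A :: D); Seq (B :: G') D']
                  (Seq (FImp A B :: G ++ G') (D ++ D'))
| r_impr A B G D : lkE_rule sg E [Seq (A :: G) (B :: D)] (Seq G (FImp A B :: D))
| r_alll s A t G D : tsort sg [] t = Some s ->
    lkE_rule sg E [Seq (inst A t :: G) D] (Seq (FAll s A :: G) D)
| r_allr s A a G D : eigen_ok s a ->
    ~ In a (snames (Seq G (FAll s A :: D))) ->
    lkE_rule sg E [Seq G (inst A (TFree a) :: D)] (Seq G (FAll s A :: D))
| r_exl s A a G D : eigen_ok s a ->
    ~ In a (snames (Seq (FEx s A :: G) D)) ->
    lkE_rule sg E [Seq (inst A (TFree a) :: G) D] (Seq (FEx s A :: G) D)
| r_exr s A t G D : tsort sg [] t = Some s ->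
    lkE_rule sg E [Seq G (inst A t :: D)] (Seq G (FEx s A :: D))
| r_E S S' : seqE E S S' -> lkE_rule sg E [S] S'.

Inductive ind_rule (sg : signature) : list sequent -> sequent -> Prop :=
| r_ind F n ms as_ t G D :
    NoDup ms -> length as_ = length ms ->
    ~ In (NPar Active n) (lnames G ++ lnames D) ->
    (forall m, In m ms -> ~ In (NPar Internal m) (lnames G ++ lnames D)) ->
    tsort sg [] t = Some SOm ->
    Forall (fun a => tsort sg [] a = Some SOm) as_ ->
    ind_rule sg
      [Seq (F :: G)
           (fsubst (upd (NPar Active n) (TSucc (TFree (NPar Active n)))) F :: D)]
      (Seq (fsubst (psub n TZero ms as_) F :: G) (fsubst (psub n t ms as_) F :: D)).

Inductive ptree :=
| PInf (concl : sequent) (prems : list ptree)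
| PLink (psi : nat) (args : list term) (concl : sequent).

Definition root (d : ptree) : sequent :=
  match d with PInf Sq _ => Sq | PLink _ _ Sq => Sq end.

Fixpoint valid (sg : signature) (E : rules) (links ind : bool) (d : ptree) : Prop :=
  match d with
  | PInf Sq ps =>
      wf_seq sg Sq /\
      (lkE_rule sg E (map root ps) Sq \/ (ind = true /\ ind_rule sg (map root ps) Sq)) /\
      (fix go (l : list ptree) : Prop :=
         match l with [] => True | p :: l' => valid sg E links ind p /\ go l' end) ps
  | PLink _ args Sq =>
      links = true /\ wf_seq sg Sq /\ Forall (fun a => tsort sg [] a = Some SOm) args
  end.

Fixpoint seqs (d : ptree) : list sequent :=
  match d with
  | PInf Sq ps => Sq :: flat_map seqs ps
  | PLink _ _ Sq => [Sq]
  end.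

Fixpoint plinks (d : ptree) : list (nat * list term * sequent) :=
  match d with
  | PInf _ ps => flat_map plinks ps
  | PLink psi args Sq => [(psi, args, Sq)]
  end.

Definition mvLKE_derivation sg E d := valid sg E false false d.
Definition mvLKS_derivation sg E d := valid sg E true false d.

Definition mvLKIE_derivation (sg : signature) (E : rules) (d : ptree) : Prop :=
  valid sg E false true d /\
  Forall (fun S => forall i j, In i (active_params S) -> In j (active_params S) -> i = j)
         (seqs d).

Record component := Comp {
  c_sym : nat;
  c_n   : nat;
  c_I   : list nat;     (* the internal parameters I (in a fixed order) *)
  c_es  : sequent;
  c_pi  : ptree;
  c_nu  : ptree
}.

Definition is_nI_sequent (S : sequent) (n : nat) (I : list nat) : Prop :=
  (forall i, In i (active_params S) <-> i = n) /\
  (forall i, In i (internal_params S) <-> In i I).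

Definition is_component (sg : signature) (E : rules) (C : component) : Prop :=
  is_nI_sequent (c_es C) (c_n C) (c_I C) /\ NoDup (c_I C) /\
  mvLKS_derivation sg E (c_pi C) /\
  root (c_pi C) = ssubst (upd (NPar Active (c_n C)) TZero) (c_es C) /\
  Forall (fun S => active_params S = []) (seqs (c_pi C)) /\
  mvLKS_derivation sg E (c_nu C) /\
  root (c_nu C) =
    ssubst (upd (NPar Active (c_n C)) (TSucc (TFree (NPar Active (c_n C))))) (c_es C) /\
  Forall (fun S => forall i, In i (active_params S) -> i = c_n C) (seqs (c_nu C)).

Definition comp_links (C : component) : list (nat * list term * sequent) :=
  plinks (c_pi C) ++ plinks (c_nu C).

Definition comp_seqs (C : component) : list sequent :=
  seqs (c_pi C) ++ seqs (c_nu C).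

Definition prec (C D : component) : Prop :=
  C <> D /\
  forall psi args S, In (psi, args, S) (comp_links C) -> psi = c_sym D ->
    forall p, In p (passive_params (c_es D)) -> In p (passive_params S).

Definition link_to (D : component) (args : list term) (S : sequent) : Prop :=
  exists t as_, args = t :: as_ /\ length as_ = length (c_I D) /\
    S = ssubst (psub (c_n D) t (c_I D) as_) (c_es D).

Definition P_schema (sg : signature) (E : rules) (P : list nat)
  (Psi : list component) : Prop :=
  Psi <> [] /\
  NoDup (map c_sym Psi) /\
  Forall (is_component sg E) Psi /\
  Forall (fun C => Forall (fun S => incl (passive_params S) P) (comp_seqs C)) Psi /\
  exists R : nat -> nat -> Prop,
    (forall i j, R i j -> exists Ci Cj, nth_error Psi i = Some Ci /\
                           nth_error Psi j = Some Cj /\ i <> j /\ prec Ci Cj) /\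
    (forall i j k, R i j -> R j k -> R i k) /\
    well_founded (fun j i => R i j) /\
    (forall j, 0 < j < length Psi -> R 0 j) /\
    (forall i Ci, nth_error Psi i = Some Ci ->
       (forall psi args S, In (psi, args, S) (plinks (c_pi Ci)) ->
          exists j Cj, nth_error Psi j = Some Cj /\ c_sym Cj = psi /\
                       i <> j /\ R i j /\ link_to Cj args S) /\
       (forall psi args S, In (psi, args, S) (plinks (c_nu Ci)) ->
          exists j Cj, nth_error Psi j = Some Cj /\ c_sym Cj = psi /\
                       link_to Cj args S /\
                       ((j = i /\ exists as_, args = TFree (NPar Active (c_n Ci)) :: as_)
                        \/ (i <> j /\ R i j)))).

Definition schema_es (Psi : list component) : option sequent :=
  match Psi with [] => None | C :: _ => Some (c_es C) end.

(* Main.v *)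
Require Import Defs.
From Stdlib Require Import List Arith Bool PeanoNat Permutation Lia.
Import ListNotations.

(** From schemata to induction: the internal parameters of a component [C] are
turned into passive ones and all parameters of its end-sequent except the active
[n] are universally quantified, giving a formula [F(n)].  Substituting into the
LK-derivation [pi] proves [F(0)], and [nu] proves [F(n')] from [F(n)], because
every self-link is an instance of [F(n)] and every other link is an instance of
the closed form of a smaller component.  One induction inference (with no
internal parameters) yields [F(t)], and thus every instance of the end-sequent.

From induction to schemata: an induction inference from
[F(n,m), G |- D, F(n',m)] becomes a component with end-sequent
[F(0,m), G |- D, F(n,m)], whose step is a cut of a self-link against the
translated premise, and the inference itself becomes a link to it.  This needs
[n] to occur in [F]; otherwise the conclusion of the inference is an axiom up to
weakening.  Since derivations are translated uniformly in a term [u] replacing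
all active parameters, taking [u := 0] and [u := n'] gives the base and the step
of a first component with the given end-sequent. *)

(** * Substitution and binding *)

Lemma term_nested_ind (P : term -> Prop) :
  P TZero -> (forall t, P t -> P (TSucc t)) -> (forall a, P (TFree a)) ->
  (forall i, P (TBVar i)) ->
  (forall f l, Forall P l -> P (TFun f l)) ->
  (forall f l, Forall P l -> P (TDef f l)) ->
  forall t, P t.
Proof.
  intros H0 HS HF HB Hf Hd.
  fix IH 1; intros [| t | a | i | f l | f l].
  - apply H0.
  - apply HS, IH.
  - apply HF.
  - apply HB.
  - apply Hf; induction l; constructor; auto.
  - apply Hd; induction l; constructor; auto.
Qed.

Lemma tsubst_ext s r t :
  (forall a, In a (tnames t) -> s a = r a) -> tsubst s t = tsubst r t.
Proof.
  induction t as [| t IH | a | i | f l IH | f l IH] using term_nested_ind;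
    simpl; intros H; f_equal; auto;
    apply map_ext_in; intros t Ht; rewrite Forall_forall in IH;
    apply IH; auto; intros a Ha; apply H, in_flat_map; eauto.
Qed.

Lemma tsubst_comp s r t :
  tsubst s (tsubst r t) = tsubst (fun a => tsubst s (r a)) t.
Proof.
  induction t as [| t IH | a | i | f l IH | f l IH] using term_nested_ind;
    simpl; f_equal; auto; rewrite map_map; apply map_ext_in; intros t Ht;
    rewrite Forall_forall in IH; auto.
Qed.

Lemma tsubst_id t : tsubst TFree t = t.
Proof.
  induction t as [| t IH | a | i | f l IH | f l IH] using term_nested_ind;
    simpl; f_equal; auto; rewrite <- (map_id l) at 2; apply map_ext_in; intros t Ht;
    rewrite Forall_forall in IH; auto.
Qed.

Lemma tnames_tsubst s t b :
  In b (tnames (tsubst s t)) <-> exists a, In a (tnames t) /\ In b (tnames (s a)).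
Proof.
  induction t as [| t IH | a | i | f l IH | f l IH] using term_nested_ind; simpl.
  1, 4: firstorder.
  - auto.
  - split; [eauto | intros (x & [<- | []] & H); auto].
  - rewrite in_flat_map; setoid_rewrite in_map_iff; setoid_rewrite in_flat_map.
    rewrite Forall_forall in IH; split.
    + intros (y & (t & <- & Ht) & Hb); apply IH in Hb as (a & Ha & Hb); eauto.
    + intros (a & (t & Ht & Ha) & Hb); exists (tsubst s t); split; eauto.
      apply IH; eauto.
  - rewrite in_flat_map; setoid_rewrite in_map_iff; setoid_rewrite in_flat_map.
    rewrite Forall_forall in IH; split.
    + intros (y & (t & <- & Ht) & Hb); apply IH in Hb as (a & Ha & Hb); eauto.
    + intros (a & (t & Ht & Ha) & Hb); exists (tsubst s t); split; eauto.
      apply IH; eauto.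
Qed.

Lemma fsubst_ext s r A :
  (forall a, In a (fnames A) -> s a = r a) -> fsubst s A = fsubst r A.
Proof.
  induction A; simpl; intros H; f_equal; auto using in_or_app.
  apply map_ext_in; intros t Ht; apply tsubst_ext; intros a Ha; apply H, in_flat_map; eauto.
Qed.

Lemma fsubst_comp s r A :
  fsubst s (fsubst r A) = fsubst (fun a => tsubst s (r a)) A.
Proof.
  induction A; simpl; f_equal; auto.
  rewrite map_map; apply map_ext_in; intros t Ht; apply tsubst_comp.
Qed.

Lemma fsubst_id A : fsubst TFree A = A.
Proof.
  induction A; simpl; f_equal; auto.
  rewrite <- (map_id args) at 2; apply map_ext, tsubst_id.
Qed.

Lemma fnames_fsubst s A b :
  In b (fnames (fsubst s A)) <-> exists a, In a (fnames A) /\ In b (tnames (s a)).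
Proof.
  induction A as [p l | A IH | A IHA B IHB | A IHA B IHB | A IHA B IHB | so A IH | so A IH];
    simpl; auto.
  2-4: setoid_rewrite in_app_iff; rewrite IHA, IHB; firstorder.
  rewrite in_flat_map; setoid_rewrite in_map_iff; setoid_rewrite in_flat_map; split.
  - intros (y & (t & <- & Ht) & Hb); apply tnames_tsubst in Hb as (a & Ha & Hb); eauto.
  - intros (a & (t & Ht & Ha) & Hb); exists (tsubst s t); split; eauto.
    apply tnames_tsubst; eauto.
Qed.

Lemma in_snames S a :
  In a (snames S) <-> exists A, (In A (ant S) \/ In A (suc S)) /\ In a (fnames A).
Proof.
  unfold snames; rewrite in_app_iff, !in_flat_map; firstorder.
Qed.

Lemma ssubst_ext s r S :
  (forall a, In a (snames S) -> s a = r a) -> ssubst s S = ssubst r S.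
Proof.
  intros H; unfold ssubst; f_equal; apply map_ext_in; intros A HA;
    apply fsubst_ext; intros a Ha; apply H, in_snames; eauto.
Qed.

Lemma ssubst_comp s r S :
  ssubst s (ssubst r S) = ssubst (fun a => tsubst s (r a)) S.
Proof.
  unfold ssubst; simpl; rewrite !map_map; f_equal; apply map_ext; intros A;
    apply fsubst_comp.
Qed.

Lemma ssubst_id S : ssubst TFree S = S.
Proof.
  destruct S as [G D]; unfold ssubst; simpl; f_equal.
  - rewrite <- (map_id G) at 2; apply map_ext, fsubst_id.
  - rewrite <- (map_id D) at 2; apply map_ext, fsubst_id.
Qed.

Lemma snames_ssubst s S b :
  In b (snames (ssubst s S)) <-> exists a, In a (snames S) /\ In b (tnames (s a)).
Proof.
  setoid_rewrite in_snames; simpl; setoid_rewrite in_map_iff; split.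
  - intros (A & [(B & <- & HB) | (B & <- & HB)] & Hb);
      apply fnames_fsubst in Hb as (a & Ha & Hb); eauto 6.
  - intros (a & (A & HA & Ha) & Hb); exists (fsubst s A); split.
    + destruct HA; eauto.
    + apply fnames_fsubst; eauto.
Qed.

Lemma in_active_params S i :
  In i (active_params S) <-> In (NPar Active i) (snames S).
Proof.
  unfold active_params; rewrite in_flat_map; split; [| intros H; exists (NPar Active i); simpl; auto].
  intros ([[] j | j] & H & Hi); simpl in Hi; try tauto; now destruct Hi as [<- |].
Qed.

Lemma in_internal_params S i :
  In i (internal_params S) <-> In (NPar Internal i) (snames S).
Proof.
  unfold internal_params; rewrite in_flat_map; split; [| intros H; exists (NPar Internal i); simpl; auto].
  intros ([[] j | j] & H & Hi); simpl in Hi; try tauto; now destruct Hi as [<- |].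
Qed.

Lemma in_passive_params S i :
  In i (passive_params S) <-> In (NPar Passive i) (snames S).
Proof.
  unfold passive_params; rewrite in_flat_map; split; [| intros H; exists (NPar Passive i); simpl; auto].
  intros ([[] j | j] & H & Hi); simpl in Hi; try tauto; now destruct Hi as [<- |].
Qed.

(** Inverse of [topen]: the free name [a] becomes the bound index [k]. It serves to build
    [FAll (fsort a) (fclose 0 a A)], the generalization of [A] over [a]. *)
Fixpoint tclose (k : nat) (a : fname) (t : term) : term :=
  match t with
  | TZero => TZero
  | TSucc v => TSucc (tclose k a v)
  | TFree b => if fname_eq_dec a b then TBVar k else TFree b
  | TBVar i => TBVar i
  | TFun f l => TFun f (map (tclose k a) l)
  | TDef f l => TDef f (map (tclose k a) l)
  end.

Fixpoint fclose (k : nat) (a : fname) (A : form) : form :=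
  match A with
  | FAtom p l => FAtom p (map (tclose k a) l)
  | FNeg B => FNeg (fclose k a B)
  | FAnd B C => FAnd (fclose k a B) (fclose k a C)
  | FOr B C => FOr (fclose k a B) (fclose k a C)
  | FImp B C => FImp (fclose k a B) (fclose k a C)
  | FAll so B => FAll so (fclose (S k) a B)
  | FEx so B => FEx so (fclose (S k) a B)
  end.

(** Instantiating a generalized name after a substitution [s] is again one simultaneous
    substitution, namely [s] overridden at [a]. *)
Definition over (a : fname) (u : term) (s : fname -> term) : fname -> term :=
  fun b => if fname_eq_dec a b then u else s b.

Lemma tnames_tclose k a t b :
  In b (tnames (tclose k a t)) <-> In b (tnames t) /\ b <> a.
Proof.
  induction t as [| t IH | c | i | f l IH | f l IH] using term_nested_ind; simpl; auto.
  1, 3: tauto.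
  - destruct (fname_eq_dec a c); simpl; intuition congruence.
  - rewrite !in_flat_map; setoid_rewrite in_map_iff; rewrite Forall_forall in IH.
    split.
    + intros (y & (t & <- & Ht) & Hb); apply IH in Hb; firstorder.
    + intros ((t & Ht & Hb) & Hn); exists (tclose k a t); split; eauto; apply IH; auto.
  - rewrite !in_flat_map; setoid_rewrite in_map_iff; rewrite Forall_forall in IH.
    split.
    + intros (y & (t & <- & Ht) & Hb); apply IH in Hb; firstorder.
    + intros ((t & Ht & Hb) & Hn); exists (tclose k a t); split; eauto; apply IH; auto.
Qed.

Lemma fnames_fclose k a A b :
  In b (fnames (fclose k a A)) <-> In b (fnames A) /\ b <> a.
Proof.
  revert k; induction A as [p l | A IH | A IHA B IHB | A IHA B IHB | A IHA B IHB | so A IH | so A IH];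
    simpl; intros k; auto.
  2-4: rewrite !in_app_iff, IHA, IHB; tauto.
  rewrite !in_flat_map; setoid_rewrite in_map_iff; split.
  - intros (y & (t & <- & Ht) & Hb); apply tnames_tclose in Hb; firstorder.
  - intros ((t & Ht & Hb) & Hn); exists (tclose k a t); split; eauto; apply tnames_tclose; auto.
Qed.

(** The second hypothesis rules out capture: substituting for a name other than [a] must not bring
    in a new [a], which closing afterwards would bind. *)
Lemma tsubst_tclose s k a t :
  s a = TFree a -> (forall b, In b (tnames t) -> In a (tnames (s b)) -> b = a) ->
  tsubst s (tclose k a t) = tclose k a (tsubst s t).
Proof.
  intros Ha; induction t as [| t IH | c | i | f l IH | f l IH] using term_nested_ind;
    simpl; intros Hs; auto; try (f_equal; auto; fail).
  - destruct (fname_eq_dec a c) as [<- | Hn]; simpl.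
    + rewrite Ha; simpl; now destruct fname_eq_dec.
    (* By the capture condition [a] is absent from the image of [c], so closing leaves that image
       unchanged. *)
    + assert (Hc : ~ In a (tnames (s c))) by (intros H; apply Hn; symmetry; auto).
      clear - Hc; induction (s c) as [| t IH | d | i | f l IH | f l IH] using term_nested_ind;
        simpl in *; auto.
      * f_equal; auto.
      * destruct (fname_eq_dec a d); [subst; tauto | auto].
      * f_equal; rewrite <- (map_id l) at 1; apply map_ext_in; intros t Ht.
        rewrite Forall_forall in IH; apply IH; auto; intros H; apply Hc, in_flat_map; eauto.
      * f_equal; rewrite <- (map_id l) at 1; apply map_ext_in; intros t Ht.
        rewrite Forall_forall in IH; apply IH; auto; intros H; apply Hc, in_flat_map; eauto.
  - f_equal; rewrite !map_map; apply map_ext_in; intros t Ht; rewrite Forall_forall in IH.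
    apply IH; auto; intros b Hb; apply Hs, in_flat_map; eauto.
  - f_equal; rewrite !map_map; apply map_ext_in; intros t Ht; rewrite Forall_forall in IH.
    apply IH; auto; intros b Hb; apply Hs, in_flat_map; eauto.
Qed.

Lemma fsubst_fclose s k a A :
  s a = TFree a -> (forall b, In b (fnames A) -> In a (tnames (s b)) -> b = a) ->
  fsubst s (fclose k a A) = fclose k a (fsubst s A).
Proof.
  intros Ha; revert k; induction A; simpl; intros k Hs; f_equal; auto using in_or_app.
  rewrite !map_map; apply map_ext_in; intros t Ht; apply tsubst_tclose; auto.
  intros b Hb; apply Hs, in_flat_map; eauto.
Qed.

(** * Sorts *)

Lemma args_ok_elem {X} (f : X -> option sort) l ss x :
  args_ok (map f l) ss = true -> In x l -> exists s, f x = Some s.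
Proof.
  revert ss; induction l as [| y l IH]; simpl; intros [| s ss] H Hx; try tauto.
  1: destruct (f y); discriminate.
  destruct (f y) eqn:Hy; [| discriminate].
  apply andb_true_iff in H as [_ H]; destruct Hx as [<- |]; eauto.
Qed.

Lemma args_ok_mono {X} (f g : X -> option sort) l ss :
  (forall x s, In x l -> f x = Some s -> g x = Some s) ->
  args_ok (map f l) ss = true -> args_ok (map g l) ss = true.
Proof.
  revert ss; induction l as [| y l IH]; simpl; intros [| s ss] Hfg H; auto.
  1: destruct (f y); discriminate.
  destruct (f y) eqn:Hy; [| discriminate].
  rewrite (Hfg y _ (or_introl eq_refl) Hy).
  apply andb_true_iff in H as [H1 H2]; rewrite H1; simpl; eauto.
Qed.

Section Calculi.

Variables (sg : signature) (E : rules).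

(** Sorting in the empty context also makes every value locally closed, so that substitution
    commutes with opening. *)
Definition sorted (s : fname -> term) : Prop :=
  forall a, tsort sg [] (s a) = Some (fsort a).

Lemma sorted_id : sorted TFree.
Proof. intros a; reflexivity. Qed.

Lemma sorted_over a u s :
  tsort sg [] u = Some (fsort a) -> sorted s -> sorted (over a u s).
Proof. intros Hu Hs b; unfold over; destruct fname_eq_dec; subst; auto. Qed.

Lemma args_sort_mono {X} (f g : X -> option sort) l ar s :
  (forall x s, In x l -> f x = Some s -> g x = Some s) ->
  (if args_ok (map f l) (fst ar) then Some (snd ar) else None) = Some s ->
  (if args_ok (map g l) (fst ar) then Some (snd ar : sort) else None) = Some s.
Proof.
  intros Hfg; destruct (args_ok (map f l) (fst ar)) eqn:Hf; [| discriminate].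
  now rewrite (args_ok_mono f g l _ Hfg Hf).
Qed.

Lemma tsort_weaken G G' t s :
  tsort sg G t = Some s -> tsort sg (G ++ G') t = Some s.
Proof.
  revert s; induction t as [| t IH | c | i | f l IH | f l IH] using term_nested_ind;
    simpl; intros s H; auto.
  - destruct (tsort sg G t) as [[]|]; try discriminate; now rewrite (IH SOm).
  - rewrite nth_error_app1; auto; apply nth_error_Some; congruence.
  - rewrite Forall_forall in IH; revert H; apply args_sort_mono; auto.
  - rewrite Forall_forall in IH; revert H; apply args_sort_mono; auto.
Qed.

Lemma tsort_tsubst s G t : sorted s -> tsort sg G (tsubst s t) = tsort sg G t.
Proof.
  intros Hs; induction t as [| t IH | c | i | f l IH | f l IH] using term_nested_ind;
    simpl; auto.
  - now rewrite IH.
  - apply (tsort_weaken [] G), Hs.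
  - rewrite map_map; rewrite Forall_forall in IH; erewrite map_ext_in; eauto.
  - rewrite map_map; rewrite Forall_forall in IH; erewrite map_ext_in; eauto.
Qed.

Lemma sorted_comp s r : sorted s -> sorted r -> sorted (fun a => tsubst s (r a)).
Proof. intros Hs Hr a; rewrite tsort_tsubst; auto. Qed.

Lemma topen_closed G k u t s :
  tsort sg G t = Some s -> length G <= k -> topen k u t = t.
Proof.
  revert s; induction t as [| t IH | c | i | f l IH | f l IH] using term_nested_ind;
    simpl; intros s H Hk; auto.
  - destruct (tsort sg G t) as [so|] eqn:Ht; [f_equal; eauto | discriminate].
  - assert (i < length G) by (apply nth_error_Some; congruence).
    destruct (Nat.eqb_spec i k); [lia | auto].
  - f_equal; rewrite <- (map_id l) at 2; apply map_ext_in; intros t Ht.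
    destruct args_ok eqn:Hl in H; [| discriminate].
    destruct (args_ok_elem _ _ _ _ Hl Ht); rewrite Forall_forall in IH; eauto.
  - f_equal; rewrite <- (map_id l) at 2; apply map_ext_in; intros t Ht.
    destruct args_ok eqn:Hl in H; [| discriminate].
    destruct (args_ok_elem _ _ _ _ Hl Ht); rewrite Forall_forall in IH; eauto.
Qed.

Lemma tsubst_topen s k u t :
  sorted s -> tsubst s (topen k u t) = topen k (tsubst s u) (tsubst s t).
Proof.
  intros Hs; induction t as [| t IH | c | i | f l IH | f l IH] using term_nested_ind;
    simpl; auto.
  - now rewrite IH.
  - symmetry; apply (topen_closed [] _ _ _ (fsort c)); simpl; auto using Nat.le_0_l.
  - now destruct Nat.eqb.
  - f_equal; rewrite !map_map; rewrite Forall_forall in IH; apply map_ext_in; auto.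
  - f_equal; rewrite !map_map; rewrite Forall_forall in IH; apply map_ext_in; auto.
Qed.

Lemma fsubst_inst s A u :
  sorted s -> fsubst s (inst A u) = inst (fsubst s A) (tsubst s u).
Proof.
  intros Hs; unfold inst; generalize 0; induction A; simpl; intros k; f_equal; auto.
  rewrite !map_map; apply map_ext; intros t; apply tsubst_topen; auto.
Qed.

(** The context [G] keeps the indices of [t] below [k], so opening at [k] meets only the places
    where [a] was abstracted; there [u] replaces the value under [s]. *)
Lemma topen_tclose s G k a u t so :
  sorted s -> tsort sg G t = Some so -> length G <= k ->
  topen k u (tsubst s (tclose k a t)) = tsubst (over a u s) t.
Proof.
  intros Hs; revert so.
  induction t as [| t IH | c | i | f l IH | f l IH] using term_nested_ind;
    simpl; intros so H Hk; auto.
  - destruct (tsort sg G t) as [so'|] eqn:Ht; [f_equal; eauto | discriminate].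
  - unfold over; destruct fname_eq_dec; simpl.
    + now rewrite Nat.eqb_refl.
    + apply (topen_closed [] _ _ _ (fsort c)); simpl; auto using Nat.le_0_l.
  - assert (i < length G) by (apply nth_error_Some; congruence).
    destruct (Nat.eqb_spec i k); [lia | auto].
  - f_equal; rewrite !map_map; apply map_ext_in; intros t Ht.
    destruct args_ok eqn:Hl in H; [| discriminate].
    destruct (args_ok_elem _ _ _ _ Hl Ht); rewrite Forall_forall in IH; eauto.
  - f_equal; rewrite !map_map; apply map_ext_in; intros t Ht.
    destruct args_ok eqn:Hl in H; [| discriminate].
    destruct (args_ok_elem _ _ _ _ Hl Ht); rewrite Forall_forall in IH; eauto.
Qed.

Lemma inst_fclose s a u A :
  sorted s -> wf_form sg [] A ->
  inst (fsubst s (fclose 0 a A)) u = fsubst (over a u s) A.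
Proof.
  intros Hs; unfold inst.
  (* Below a quantifier both the context and the closed index grow by one, so the bound between them
     is what the induction carries. *)
  enough (H : forall G k, wf_form sg G A -> length G <= k ->
    fopen k u (fsubst s (fclose k a A)) = fsubst (over a u s) A) by (intros; eapply H; eauto).
  induction A; simpl; intros G k H Hk; try (f_equal; intuition eauto; fail).
  - f_equal; rewrite !map_map; apply map_ext_in; intros t Ht.
    destruct (args_ok_elem _ _ _ _ H Ht); eapply topen_tclose; eauto.
  - f_equal; eapply IHA; eauto; simpl; lia.
  - f_equal; eapply IHA; eauto; simpl; lia.
Qed.

Lemma tsort_tclose G a t s :
  tsort sg G t = Some s -> tsort sg (G ++ [fsort a]) (tclose (length G) a t) = Some s.
Proof.
  revert s; induction t as [| t IH | c | i | f l IH | f l IH] using term_nested_ind;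
    simpl; intros s H; auto.
  - destruct (tsort sg G t) as [[]|]; try discriminate; now rewrite (IH SOm).
  - destruct fname_eq_dec; subst; simpl; auto.
    rewrite nth_error_app2, Nat.sub_diag; auto.
  - rewrite nth_error_app1; auto; apply nth_error_Some; congruence.
  - rewrite map_map; rewrite Forall_forall in IH; revert H; apply args_sort_mono; auto.
  - rewrite map_map; rewrite Forall_forall in IH; revert H; apply args_sort_mono; auto.
Qed.

Lemma wf_fclose a A :
  wf_form sg [] A -> wf_form sg [fsort a] (fclose 0 a A).
Proof.
  (* The closed name gets the index [length G], beyond all inner binders, so its sort stands at the
     far end of the context. *)
  enough (H : forall G, wf_form sg G A ->
    wf_form sg (G ++ [fsort a]) (fclose (length G) a A)) by apply (H []).
  induction A; simpl; intros G H; intuition auto.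
  - rewrite map_map; revert H; apply args_ok_mono; auto using tsort_tclose.
  - apply (IHA (s :: G)); auto.
  - apply (IHA (s :: G)); auto.
Qed.

Lemma wf_fsubst s G A : sorted s -> wf_form sg G A -> wf_form sg G (fsubst s A).
Proof.
  intros Hs; revert G; induction A; simpl; intros G H; intuition auto.
  rewrite map_map; revert H; apply args_ok_mono; intros t so _ <-; apply tsort_tsubst; auto.
Qed.

Lemma wf_fsubst_inv s G A : sorted s -> wf_form sg G (fsubst s A) -> wf_form sg G A.
Proof.
  intros Hs; revert G; induction A; simpl; intros G H; intuition eauto.
  rewrite map_map in H; revert H; apply args_ok_mono; intros t so _ <-; symmetry; apply tsort_tsubst; auto.
Qed.

(** * Derivability *)

Section Derivability.

Variable ok : nat -> Prop.

Definition good (A : form) : Prop :=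
  wf_form sg [] A /\ forall i, In (NPar Active i) (fnames A) -> ok i.

Definition good_seq (S : sequent) : Prop :=
  Forall good (ant S) /\ Forall good (suc S).

Definition good_subst (s : fname -> term) : Prop :=
  sorted s /\ forall a i, In (NPar Active i) (tnames (s a)) -> ok i.

Lemma good_seq_iff S :
  good_seq S <-> wf_seq sg S /\ forall i, In i (active_params S) -> ok i.
Proof.
  unfold good_seq, wf_seq, good; setoid_rewrite in_active_params.
  setoid_rewrite in_snames; rewrite !Forall_forall; firstorder.
Qed.

Lemma good_fsubst s A : good_subst s -> wf_form sg [] A -> good (fsubst s A).
Proof.
  intros [Hs Ha] HA; split; [apply wf_fsubst; auto |].
  intros i Hi; apply fnames_fsubst in Hi as (a & _ & Hi); eauto.
Qed.

Lemma good_ssubst s S : good_subst s -> wf_seq sg S -> good_seq (ssubst s S).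
Proof.
  intros Hs [HG HD]; split; simpl; apply Forall_map;
    [revert HG | revert HD]; apply Forall_impl; intros A; apply good_fsubst; auto.
Qed.

Lemma good_comp s r : good_subst s -> sorted r -> good_subst (fun a => tsubst s (r a)).
Proof.
  intros [Hs Ha] Hr; split; [apply sorted_comp; auto |].
  intros a i Hi; apply tnames_tsubst in Hi as (b & _ & Hi); eauto.
Qed.

Lemma good_over a u s :
  tsort sg [] u = Some (fsort a) -> (forall i, In (NPar Active i) (tnames u) -> ok i) ->
  good_subst s -> good_subst (over a u s).
Proof.
  intros Hu Hk [Hs Ha]; split; [apply sorted_over; auto |].
  intros b i; unfold over; destruct fname_eq_dec; eauto.
Qed.

Lemma good_seq_cons_r A G D :
  good_seq (Seq G (A :: D)) <-> good A /\ good_seq (Seq G D).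
Proof. unfold good_seq; simpl; rewrite Forall_cons_iff; tauto. Qed.

Lemma good_seq_cons_l A G D :
  good_seq (Seq (A :: G) D) <-> good A /\ good_seq (Seq G D).
Proof. unfold good_seq; simpl; rewrite Forall_cons_iff; tauto. Qed.

Lemma good_or A B : good (FOr A B) <-> good A /\ good B.
Proof. unfold good; simpl; setoid_rewrite in_app_iff; firstorder. Qed.

Variables (links ind : bool) (lk : nat * list term * sequent -> Prop).

(** One predicate for both calculi, selected by [links] and [ind], so that the structural rules are
    derived only once. The condition [lk] records which links may occur as leaves. *)
Definition derivable (S : sequent) : Prop :=
  exists d, valid sg E links ind d /\ root d = S /\
    Forall (fun S' => forall i, In i (active_params S') -> ok i) (seqs d) /\
    Forall lk (plinks d).

Lemma derivable_good S : derivable S -> good_seq S.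
Proof.
  intros (d & Hv & <- & Ha & _); apply good_seq_iff; split.
  - destruct d; simpl in Hv; tauto.
  - destruct d; inversion Ha; auto.
Qed.

Lemma valid_inf S ps :
  valid sg E links ind (PInf S ps) <->
  wf_seq sg S /\
  (lkE_rule sg E (map root ps) S \/ ind = true /\ ind_rule sg (map root ps) S) /\
  Forall (valid sg E links ind) ps.
Proof.
  simpl; do 2 (apply and_iff_compat_l).
  induction ps as [| p ps IH]; simpl; [split; auto |].
  rewrite IH, Forall_cons_iff; reflexivity.
Qed.

Lemma derivable_inf ps S :
  good_seq S -> lkE_rule sg E ps S \/ ind = true /\ ind_rule sg ps S ->
  Forall derivable ps -> derivable S.
Proof.
  intros HS Hr Hps; apply good_seq_iff in HS as [Hwf Ha].
  assert (H : exists ds, map root ds = ps /\ Forall (valid sg E links ind) ds /\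
    Forall (fun S' => forall i, In i (active_params S') -> ok i) (flat_map seqs ds) /\
    Forall lk (flat_map plinks ds)).
  { clear Hr; induction Hps as [| p ps (d & Hv & Hd & Had & Hl) _ (ds & <- & Hvs & Has & Hls)].
    - exists []; simpl; auto.
    - exists (d :: ds); simpl; rewrite !Forall_app; subst; auto. }
  destruct H as (ds & <- & Hvs & Has & Hls).
  exists (PInf S ds); rewrite valid_inf; simpl; repeat split; auto; apply Hwf.
Qed.

Lemma derivable_rule1 p S :
  lkE_rule sg E [p] S -> good_seq S -> derivable p -> derivable S.
Proof. intros; apply (derivable_inf [p]); auto. Qed.

Lemma derivable_exch G D G' D' :
  Permutation G G' -> Permutation D D' ->
  derivable (Seq G D) -> derivable (Seq G' D').
Proof.
  intros HG HD H; apply (derivable_rule1 (Seq G D)); auto using lkE_rule.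
  apply derivable_good in H as [H1 H2]; split; simpl in *.
  - rewrite <- HG; auto.
  - rewrite <- HD; auto.
Qed.

Lemma derivable_weaken G D G' D' :
  Forall good G' -> Forall good D' ->
  derivable (Seq G D) -> derivable (Seq (G' ++ G) (D' ++ D)).
Proof.
  intros HG HD H; induction HG as [| A G' HA HG IH]; simpl.
  - induction HD as [| A D' HA HD IH]; simpl; auto.
    apply derivable_good in IH as Hg; destruct Hg.
    eapply derivable_rule1; [apply r_wr | split; simpl; auto | auto].
  - apply derivable_good in IH as Hg; destruct Hg.
    eapply derivable_rule1; [apply r_wl | split; simpl; auto | auto].
Qed.

Lemma derivable_contract G D G' D' :
  incl G' G -> incl D' D ->
  derivable (Seq (G' ++ G) (D' ++ D)) -> derivable (Seq G D).
Proof.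
  intros HG HD H.
  assert (H' : derivable (Seq G (D' ++ D))).
  { induction G' as [| A G' IH]; simpl in *; auto.
    apply IH; [intros B HB; apply HG; simpl; auto |].
    destruct (in_split A (G' ++ G)) as (G1 & G2 & HA).
    { apply in_or_app; right; apply HG; simpl; auto. }
    rewrite HA in *; apply (derivable_exch (A :: G1 ++ G2) (D' ++ D));
      auto using Permutation_middle.
    apply (derivable_exch _ _ (A :: A :: G1 ++ G2) (D' ++ D)) in H; auto.
    - apply derivable_good in H as Hg; destruct Hg as [Hg1 Hg2]; inversion Hg1.
      eapply derivable_rule1; [apply r_cl | split; simpl; auto | auto].
    - constructor; symmetry; apply Permutation_middle. }
  clear H; induction D' as [| A D' IH]; simpl in *; auto.
  apply IH; [intros B HB; apply HD; simpl; auto |].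
  destruct (in_split A (D' ++ D)) as (D1 & D2 & HA).
  { apply in_or_app; right; apply HD; simpl; auto. }
  rewrite HA in *; apply (derivable_exch G (A :: D1 ++ D2)); auto using Permutation_middle.
  apply (derivable_exch _ _ G (A :: A :: D1 ++ D2)) in H'; auto.
  - apply derivable_good in H' as Hg; destruct Hg as [Hg1 Hg2]; inversion Hg2.
    eapply derivable_rule1; [apply r_cr | split; simpl; auto | auto].
  - constructor; symmetry; apply Permutation_middle.
Qed.

(** Weakening by the whole new sequent and contracting the old one away: up to derivability, both
    sides of a sequent behave as sets. *)
Lemma derivable_incl G D G' D' :
  derivable (Seq G D) -> incl G G' -> incl D D' -> good_seq (Seq G' D') ->
  derivable (Seq G' D').
Proof.
  intros H HG HD [Hg1 Hg2]; apply (derivable_contract _ _ G D); auto.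
  apply (derivable_exch (G' ++ G) (D' ++ D)); auto using Permutation_app_comm.
  apply derivable_weaken; auto.
Qed.

Lemma derivable_ax A G D :
  In A G -> In A D -> good_seq (Seq G D) -> derivable (Seq G D).
Proof.
  intros HG HD Hg; apply (derivable_incl [A] [A]); auto.
  - assert (good A) by (destruct Hg as [H _]; rewrite Forall_forall in H; apply H; auto).
    apply (derivable_inf []); auto using lkE_rule; split; simpl; auto.
  - intros B [<- | []]; auto.
  - intros B [<- | []]; auto.
Qed.

(** The primitive cut concatenates its contexts; contraction merges the two copies into a shared
    one. *)
Lemma derivable_cut A G D :
  derivable (Seq G (A :: D)) -> derivable (Seq (A :: G) D) -> derivable (Seq G D).
Proof.
  intros H1 H2.
  assert (HG := derivable_good _ H1); assert (HD := derivable_good _ H2).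
  destruct HG as [HG _], HD as [_ HD]; simpl in *.
  apply (derivable_contract _ _ G D); try apply incl_refl.
  apply (derivable_inf [Seq G (A :: D); Seq (A :: G) D]); auto using lkE_rule.
  split; simpl; apply Forall_app; auto.
Qed.

Lemma derivable_negs_in As G D :
  derivable (Seq (As ++ G) D) -> derivable (Seq G (map FNeg As ++ D)).
Proof.
  revert D; induction As as [| A As IH]; simpl; intros D H; auto.
  assert (Hg := derivable_good _ H); apply good_seq_cons_l in Hg as [HA Hg].
  apply (derivable_exch G (map FNeg As ++ FNeg A :: D)); auto.
  - symmetry; apply Permutation_middle.
  - apply IH; eapply derivable_rule1; [apply r_negr | apply good_seq_cons_r; auto | auto].
Qed.

(** Inverts negation on the right: each [FNeg A] is cut against the sequent with both [FNeg A] and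
    [A] on the left, which comes from an axiom. *)
Lemma derivable_negs_out As G D :
  derivable (Seq G (map FNeg As ++ D)) -> derivable (Seq (As ++ G) D).
Proof.
  revert G; induction As as [| A As IH]; simpl; intros G H; auto.
  assert (Hg := derivable_good _ H); apply good_seq_cons_r in Hg as [HA Hg].
  apply (derivable_exch (As ++ A :: G) D); auto.
  - symmetry; apply Permutation_middle.
  - apply IH, (derivable_cut (FNeg A)).
    + apply (derivable_incl _ _ _ _ H); auto using incl_refl, incl_tl.
      apply good_seq_cons_l; split; auto; apply good_seq_cons_r; auto.
    + assert (Hg' : good_seq (Seq (A :: G) (A :: map FNeg As ++ D))).
      { apply good_seq_cons_l; split; auto; apply good_seq_cons_r; auto. }
      eapply derivable_rule1; [apply r_negl | |
        apply (derivable_ax A); simpl; auto].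
      rewrite !good_seq_cons_l; auto.
Qed.

End Derivability.

(** * Sequents as universally closed formulas *)

(* [disj []] is junk: [FAtom 0 []] need not even be well-formed. *)
Fixpoint disj (l : list form) : form :=
  match l with
  | [] => FAtom 0 []
  | [A] => A
  | A :: l' => FOr A (disj l')
  end.

Definition seq_form (S : sequent) : form := disj (map FNeg (ant S) ++ suc S).

(** The list may repeat a name: the innermost quantifier for it binds, and the outer ones are
    vacuous. *)
Definition closure (L : list fname) (A : form) : form :=
  fold_right (fun a B => FAll (fsort a) (fclose 0 a B)) A L.

Lemma fnames_closure L A b : In b (fnames (closure L A)) <-> In b (fnames A) /\ ~ In b L.
Proof.
  induction L as [| a L IH]; simpl; [tauto |].
  rewrite fnames_fclose, IH; intuition.
Qed.

Lemma wf_closure L A : wf_form sg [] A -> wf_form sg [] (closure L A).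
Proof. intros HA; induction L as [| a L IH]; simpl; auto using wf_fclose. Qed.

Lemma fsubst_closure s L A :
  (forall a, In a L -> s a = TFree a) ->
  (forall a b, In a L -> In a (tnames (s b)) -> b = a) ->
  fsubst s (closure L A) = closure L (fsubst s A).
Proof.
  induction L as [| a L IH]; simpl; intros H1 H2; f_equal; auto.
  rewrite fsubst_fclose; [rewrite IH | | ]; eauto.
Qed.

Section SequentFormulas.

Variables (ok : nat -> Prop) (links ind : bool) (lk : nat * list term * sequent -> Prop).

Local Notation der := (derivable ok links ind lk).
Local Notation gd := (good ok).
Local Notation gds := (good_seq ok).

Lemma good_disj l : l <> [] -> gd (disj l) <-> Forall gd l.
Proof.
  intros Hl; induction l as [| A l IH]; [congruence |].
  destruct l as [| B l].
  - simpl; rewrite Forall_cons_iff; split; [auto | intros []; auto].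
  - change (disj (A :: B :: l)) with (FOr A (disj (B :: l))).
    rewrite good_or, IH by discriminate; symmetry; apply Forall_cons_iff.
Qed.

Lemma derivable_disj_in l G D :
  l <> [] -> der (Seq G (l ++ D)) -> der (Seq G (disj l :: D)).
Proof.
  intros Hl; revert D; induction l as [| A l IH]; [tauto |]; intros D H.
  destruct l as [| B l]; [auto |].
  apply (derivable_exch _ _ _ _ _ _ G ((B :: l) ++ A :: D)) in H;
    [| auto | simpl; apply (Permutation_middle (B :: l))].
  apply IH in H; [| discriminate].
  change (disj (A :: B :: l)) with (FOr A (disj (B :: l))).
  set (C := disj (B :: l)) in *.
  assert (Hg := derivable_good _ _ _ _ _ H).
  apply good_seq_cons_r in Hg as [HC Hg]; apply good_seq_cons_r in Hg as [HA Hg].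
  assert (HO : gd (FOr A C)) by (apply good_or; auto).
  (* The right rules for disjunction take one disjunct at a time, so both [C] and [A] are turned
     into the disjunction and the copies contracted. *)
  assert (H1 : der (Seq G (FOr A C :: A :: D))).
  { eapply derivable_rule1; [apply r_orr2 | | apply H]; rewrite !good_seq_cons_r; auto. }
  assert (H2 : der (Seq G (FOr A C :: FOr A C :: D))).
  { eapply derivable_rule1; [apply r_orr1 | rewrite !good_seq_cons_r; auto |].
    apply (derivable_exch _ _ _ _ _ _ _ _ (Permutation_refl _) (perm_swap _ _ _) H1). }
  eapply derivable_rule1; [apply r_cr | rewrite !good_seq_cons_r; auto | auto].
Qed.

Lemma derivable_disj_ax l : l <> [] -> Forall gd l -> der (Seq [disj l] l).
Proof.
  intros Hl Hg; induction Hg as [| A l HA Hg IH]; [tauto |].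
  destruct l as [| B l].
  - apply (derivable_ax _ _ _ _ A); simpl; auto; split; simpl; auto.
  - change (disj (A :: B :: l)) with (FOr A (disj (B :: l))).
    assert (HC : gd (disj (B :: l))) by (apply good_disj; [discriminate | auto]).
    set (C := disj (B :: l)) in *; specialize (IH ltac:(discriminate)).
    apply (derivable_inf _ _ _ _ [Seq [A] (A :: B :: l); Seq [C] (A :: B :: l)]).
    + rewrite good_seq_cons_l, good_or; split; auto; split; simpl; auto.
    + left; apply r_orl.
    + repeat constructor.
      * apply (derivable_ax _ _ _ _ A); simpl; auto; split; simpl; auto.
      * apply (derivable_incl _ _ _ _ _ _ _ _ IH); auto using incl_refl, incl_tl.
        split; simpl; auto.
Qed.

Lemma fsubst_disj s l : l <> [] -> fsubst s (disj l) = disj (map (fsubst s) l).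
Proof.
  induction l as [| A [| B l] IH]; [congruence | auto |]; intros _.
  change (disj (A :: B :: l)) with (FOr A (disj (B :: l))).
  change (FOr (fsubst s A) (fsubst s (disj (B :: l))) = disj (map (fsubst s) (A :: B :: l))).
  rewrite IH by discriminate; reflexivity.
Qed.

(** Excludes the empty sequent, whose formula would be the junk value of [disj]. An end-sequent of a
    component is never empty, since it contains an active parameter. *)
Definition nonempty_seq (S : sequent) : Prop := map FNeg (ant S) ++ suc S <> [].

Lemma nonempty_ssubst s S : nonempty_seq S -> nonempty_seq (ssubst s S).
Proof. unfold nonempty_seq; destruct S as [[] []]; simpl; try discriminate; auto. Qed.

Lemma seq_form_ssubst s S :
  nonempty_seq S -> seq_form (ssubst s S) = fsubst s (seq_form S).
Proof.
  intros HS; unfold seq_form; rewrite fsubst_disj by auto; f_equal.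
  simpl; rewrite map_app, !map_map; reflexivity.
Qed.

Lemma good_seq_form S : nonempty_seq S -> gd (seq_form S) <-> gds S.
Proof.
  intros HS; unfold seq_form; rewrite good_disj by auto.
  rewrite Forall_app, Forall_map; reflexivity.
Qed.

(** From left to right, the disjunction is cut against the sequent that splits it into its
    disjuncts, and the negations return to the antecedent. The hypotheses [H] leave room for the
    induction hypothesis. *)
Lemma derivable_seq_form S H :
  nonempty_seq S -> gds S ->
  der (Seq H [seq_form S]) <-> der (Seq (ant S ++ H) (suc S)).
Proof.
  intros HS Hg; split; intros Hd.
  - apply derivable_negs_out, (derivable_cut _ _ _ _ (seq_form S)).
    + apply (derivable_incl _ _ _ _ _ _ _ _ Hd); [apply incl_refl | |].
      * intros B [<- | []]; simpl; auto.
      * assert (Hgd := derivable_good _ _ _ _ _ Hd); apply good_seq_cons_r in Hgd as [Hf Hh].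
        apply good_seq_cons_r; split; auto; split; [apply Hh |].
        apply good_disj; auto.
    + assert (Hgd := derivable_good _ _ _ _ _ Hd); apply good_seq_cons_r in Hgd as [Hf Hh].
      apply good_disj in Hf as Hl; auto.
      apply (derivable_incl _ _ _ _ _ _ _ _ (derivable_disj_ax _ HS Hl)).
      * intros B [<- | []]; simpl; auto.
      * apply incl_refl.
      * apply good_seq_cons_l; split; auto; split; [apply Hh | auto].
  - apply derivable_negs_in in Hd.
    apply derivable_disj_in; auto; rewrite app_nil_r; auto.
Qed.

Definition eigen (a : fname) : Prop := eigen_ok (fsort a) a.

Lemma derivable_forall_in a A G D :
  eigen a -> ~ In a (snames (Seq G D)) ->
  der (Seq G (A :: D)) -> der (Seq G (FAll (fsort a) (fclose 0 a A) :: D)).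
Proof.
  intros Ha Hn H; assert (Hg := derivable_good _ _ _ _ _ H).
  apply good_seq_cons_r in Hg as [[HA Hk] Hg].
  eapply derivable_rule1; [apply (r_allr _ _ _ _ a) | |]; auto.
  - intros Hin; apply Hn; revert Hin; rewrite !in_snames; simpl.
    intros (B & [HB | [<- | HB]] & Hin); eauto.
    simpl in Hin; apply fnames_fclose in Hin; tauto.
  - apply good_seq_cons_r; split; auto; split.
    + apply wf_fclose; auto.
    + simpl; intros i Hi; apply fnames_fclose in Hi; apply Hk, Hi.
  (* Opening the closed formula at [a] itself restores [A]. *)
  - rewrite <- (fsubst_id (fclose 0 a A)), inst_fclose; auto using sorted_id.
    rewrite (fsubst_ext _ TFree), fsubst_id; auto.
    intros b _; unfold over; destruct fname_eq_dec; congruence.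
Qed.

(** Inverts the right universal rule by a cut with the left one. The substitution [s] in front
    accumulates the instantiations of quantifiers removed earlier. *)
Lemma derivable_forall_out a A s u G D :
  sorted s -> wf_form sg [] A -> gd (fsubst (over a u s) A) ->
  tsort sg [] u = Some (fsort a) ->
  der (Seq G (fsubst s (FAll (fsort a) (fclose 0 a A)) :: D)) ->
  der (Seq G (fsubst (over a u s) A :: D)).
Proof.
  intros Hs HA HA' Hu H; set (F := fsubst s _) in H.
  assert (Hg := derivable_good _ _ _ _ _ H); apply good_seq_cons_r in Hg as [HF Hg].
  apply (derivable_cut _ _ _ _ F).
  - apply (derivable_incl _ _ _ _ _ _ _ _ H); auto using incl_refl.
    + intros B [<- | HB]; simpl; auto.
    + rewrite !good_seq_cons_r; auto.
  - unfold F; simpl; eapply derivable_rule1; [apply (r_alll _ _ _ _ u); auto | |].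
    + rewrite good_seq_cons_l, good_seq_cons_r; auto.
    + rewrite inst_fclose by auto; eapply derivable_ax; simpl; auto.
      rewrite good_seq_cons_l, good_seq_cons_r; auto.
Qed.

Lemma derivable_closure L A G :
  Forall eigen L -> (forall a, In a L -> ~ In a (lnames G)) ->
  der (Seq G [A]) -> der (Seq G [closure L A]).
Proof.
  intros HL; induction HL as [| a L Ha HL IH]; simpl; intros HG H; auto.
  apply derivable_forall_in; auto.
  unfold snames; simpl; rewrite app_nil_r; apply HG; auto.
Qed.

(** The quantifiers are removed from the outside, each instantiated as [r] prescribes. Meanwhile [s]
    is updated, so that it always agrees with [r] on the names of [A] no longer bound. *)
Lemma derivable_closure_inst L A s r G :
  good_subst ok s -> good_subst ok r -> wf_form sg [] A ->
  (forall b, In b (fnames A) -> ~ In b L -> s b = r b) ->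
  der (Seq G [fsubst s (closure L A)]) -> der (Seq G [fsubst r A]).
Proof.
  intros Hs Hr HA; revert s Hs; induction L as [| a L IH]; intros s Hs Hsr H.
  - rewrite <- (fsubst_ext s); auto.
  - assert (Ho : good_subst ok (over a (r a) s)).
    { apply good_over; auto; apply Hr. }
    apply (IH (over a (r a) s)); auto.
    + intros b Hb Hn; unfold over; destruct fname_eq_dec; [congruence |].
      apply Hsr; auto; intros [|]; auto.
    + apply derivable_forall_out; auto using wf_closure, good_fsubst.
      * apply Hs.
      * apply Hr.
Qed.

End SequentFormulas.

(** * Rules under substitution and under additional hypotheses *)

Lemma eqE_tsubst s t u : eqE E t u -> eqE E (tsubst s t) (tsubst s u).
Proof.
  (* The arguments of function symbols are related through [Forall2], so the recursion must run on
     the derivation itself to reach them. *)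
  revert t u; fix IH 3; intros t u [t' | t' u' H | t' u' v H1 H2 | t' u' H | f l l' H | f l l' H | l r s' H].
  - apply eqE_refl.
  - apply eqE_sym, IH, H.
  - eapply eqE_trans; apply IH; [apply H1 | apply H2].
  - apply eqE_succ, IH, H.
  - apply eqE_fun; induction H; simpl; constructor; auto.
  - apply eqE_def; induction H; simpl; constructor; auto.
  - rewrite !tsubst_comp; apply eqE_rule, H.
Qed.

Lemma feqE_fsubst s A B : feqE E A B -> feqE E (fsubst s A) (fsubst s B).
Proof.
  revert B; induction A; intros []; simpl; intuition.
  match goal with H : Forall2 _ _ _ |- _ => induction H; simpl; constructor end;
    auto using eqE_tsubst.
Qed.

Lemma feqE_refl A : feqE E A A.
Proof.
  induction A; simpl; auto; split; auto.
  induction args; constructor; auto using eqE_refl.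
Qed.

Lemma seqE_ssubst s S S' : seqE E S S' -> seqE E (ssubst s S) (ssubst s S').
Proof.
  intros [H1 H2]; split; simpl; [clear H2; induction H1 | clear H1; induction H2];
    simpl; constructor; auto using feqE_fsubst.
Qed.

Lemma eigen_ok_inv so a : eigen_ok so a -> so = fsort a /\ eigen a.
Proof. destruct so, a as [[] i | i]; simpl; tauto. Qed.

(* A substitution commutes with the rules as soon as it renames the names not
   occurring in the conclusion, hence any eigenvariable, to fresh ones. *)
Definition renames_fresh (s : fname -> term) (S : sequent) : Prop :=
  forall a, eigen a -> ~ In a (snames S) ->
    exists a', s a = TFree a' /\ eigen a' /\ fsort a' = fsort a /\
      ~ In a' (snames (ssubst s S)).

(** Only the strong quantifier rules depend on the choice of a particular name; their eigenvariable
    is exchanged for the fresh one. *)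
Lemma lkE_rule_ssubst s ps S :
  sorted s -> renames_fresh s S -> lkE_rule sg E ps S ->
  lkE_rule sg E (map (ssubst s) ps) (ssubst s S).
Proof.
  intros Hs Hf H; revert Hf; unfold ssubst at 2; destruct H; simpl; intros Hf;
    rewrite ?map_app; try (unfold ssubst; simpl; rewrite ?map_app; econstructor; fail).
  - unfold ssubst; simpl; apply r_exch; apply Permutation_map; auto.
  - unfold ssubst; simpl; rewrite fsubst_inst by auto; apply r_alll.
    rewrite tsort_tsubst; auto.
  - apply eigen_ok_inv in H as [-> Ha].
    destruct (Hf a Ha H0) as (a' & Has & Ha' & Hso & Hn).
    unfold ssubst; simpl; rewrite fsubst_inst by auto; simpl; rewrite Has.
    apply r_allr; [rewrite <- Hso; auto | apply Hn].
  - apply eigen_ok_inv in H as [-> Ha].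
    destruct (Hf a Ha H0) as (a' & Has & Ha' & Hso & Hn).
    unfold ssubst; simpl; rewrite fsubst_inst by auto; simpl; rewrite Has.
    apply r_exl; [rewrite <- Hso; auto | apply Hn].
  - unfold ssubst; simpl; rewrite fsubst_inst by auto; apply r_exr.
    rewrite tsort_tsubst; auto.
  - apply r_E; apply (seqE_ssubst s) in H; apply H.
Qed.

Definition name_index (a : fname) : nat :=
  match a with NPar _ i => i | NVar i => i end.

(** Only passive and iota names outside [S] change their value, so the image of [S] stays the same.
    All names of one kind go to one fresh name: an inference has at most one eigenvariable, so
    identifying them does no harm. *)
Lemma exists_renaming_fresh ok s S :
  good_subst ok s ->
  exists s', good_subst ok s' /\ renames_fresh s' S /\
    (forall i, s' (NPar Active i) = s (NPar Active i)) /\ ssubst s' S = ssubst s S.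
Proof.
  intros [Hs Hk].
  set (m := Datatypes.S (list_max (map name_index (snames (ssubst s S))))).
  assert (Hm : forall a, name_index a = m -> ~ In a (snames (ssubst s S))).
  { intros a Ha Hin; apply (in_map name_index) in Hin.
    enough (name_index a <= list_max (map name_index (snames (ssubst s S)))) by lia.
    assert (H := list_max_le (map name_index (snames (ssubst s S)))
                   (list_max (map name_index (snames (ssubst s S))))).
    destruct H as [H _]; specialize (H (le_n _)); rewrite Forall_forall in H; auto. }
  exists (fun a => if in_dec fname_eq_dec a (snames S) then s a else
     match a with
     | NPar Passive _ => TFree (NPar Passive m)
     | NVar _ => TFree (NVar m)
     | _ => s a
     end).
  assert (He : ssubst (fun a => if in_dec fname_eq_dec a (snames S) then s a else
     match a with
     | NPar Passive _ => TFree (NPar Passive m)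
     | NVar _ => TFree (NVar m)
     | _ => s a
     end) S = ssubst s S).
  { apply ssubst_ext; intros a Ha; destruct in_dec; tauto. }
  split; [split | split; [| split]].
  - intros a; destruct in_dec; auto; destruct a as [[] i | i]; auto.
  - intros a i; destruct in_dec; eauto.
    destruct a as [[] j | j]; simpl; eauto; intros [|[]]; discriminate.
  - intros a Ha Hn; rewrite He; destruct in_dec; [tauto |].
    destruct a as [[] i | i]; unfold eigen in Ha; simpl in Ha; try tauto.
    + exists (NPar Passive m); do 3 (split; [exact I || reflexivity |]); auto.
    + exists (NVar m); do 3 (split; [exact I || reflexivity |]); auto.
  - intros i; destruct in_dec; auto.
  - apply He.
Qed.

(** The hypotheses go to the end, so that the principal formulas of the rules stay in front. *)
Definition add_hyps (H : list form) (S : sequent) : sequent :=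
  Seq (ant S ++ H) (suc S).

Section Derivations.

Variables (ok : nat -> Prop) (links ind : bool) (lk : nat * list term * sequent -> Prop).

Local Notation der := (derivable ok links ind lk).

Lemma derivable_add_hyps H ps S :
  lkE_rule sg E ps S -> (forall a, eigen a -> ~ In a (lnames H)) ->
  good_seq ok (add_hyps H S) -> Forall der (map (add_hyps H) ps) -> der (add_hyps H S).
Proof.
  intros HR HH Hg Hps; unfold add_hyps in *; destruct HR; simpl in *;
    try (eapply derivable_inf; [exact Hg | left; econstructor | exact Hps]; fail).
  - apply (derivable_ax _ _ _ _ A); simpl; auto.
  - eapply derivable_inf; [exact Hg | left; eapply r_exch | exact Hps];
      auto using Permutation_app_tail.
  (* Cut concatenates the antecedents, so [H] arrives twice and the copies are merged; the same
     happens next for implication on the left. *)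
  - inversion_clear Hps as [| ? ? H1 H2]; inversion_clear H2 as [| ? ? H3 _].
    apply (derivable_incl _ _ _ _ ((G ++ H) ++ (G' ++ H)) (D ++ D')); auto using incl_refl.
    + assert (Hg1 := derivable_good _ _ _ _ _ H1); assert (Hg2 := derivable_good _ _ _ _ _ H3).
      apply good_seq_cons_r in Hg1 as [HA [Hg1 Hg1']].
      apply good_seq_cons_l in Hg2 as [_ [Hg2 Hg2']].
      eapply derivable_inf; [| left; apply (r_cut _ _ A) | auto].
      split; simpl; apply Forall_app; auto.
    + intros B HB; rewrite !in_app_iff in *; tauto.
  - inversion_clear Hps as [| ? ? H1 H2]; inversion_clear H2 as [| ? ? H3 _].
    apply (derivable_incl _ _ _ _ (FImp A B :: (G ++ H) ++ (G' ++ H)) (D ++ D'));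
      auto using incl_refl.
    + assert (Hg1 := derivable_good _ _ _ _ _ H1); assert (Hg2 := derivable_good _ _ _ _ _ H3).
      apply good_seq_cons_r in Hg1 as [HA [Hg1 Hg1']].
      apply good_seq_cons_l in Hg2 as [_ [Hg2 Hg2']].
      apply good_seq_cons_l in Hg as [Hi Hg].
      eapply derivable_inf; [| left; apply r_impl | auto].
      apply good_seq_cons_l; split; auto.
      split; simpl; apply Forall_app; auto.
    + intros C HC; simpl in *; rewrite !in_app_iff in *; tauto.
  - eapply derivable_inf; [exact Hg | left; eapply r_alll; eauto | exact Hps].
  (* The eigenvariable condition survives, because [H] contains no name that can be an
     eigenvariable. *)
  - apply eigen_ok_inv in H0 as H2; destruct H2 as [-> Ha].
    eapply derivable_inf; [exact Hg | left; eapply r_allr | exact Hps]; auto.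
    intros Hin; apply in_snames in Hin as (B & HB & Hin); simpl in HB.
    rewrite in_app_iff in HB.
    destruct HB as [[HB | HB] | HB];
      [apply H1, in_snames; eauto | | apply H1, in_snames; simpl; eauto].
    apply (HH a Ha), in_flat_map; eauto.
  - apply eigen_ok_inv in H0 as H2; destruct H2 as [-> Ha].
    eapply derivable_inf; [exact Hg | left; eapply r_exl | exact Hps]; auto.
    intros Hin; apply in_snames in Hin as (B & HB & Hin); simpl in HB.
    rewrite in_app_iff in HB.
    destruct HB as [[HB | [HB | HB]] | HB];
      [apply H1, in_snames; simpl; eauto | apply H1, in_snames; simpl; eauto |
       | apply H1, in_snames; eauto].
    apply (HH a Ha), in_flat_map; eauto.
  - eapply derivable_inf; [exact Hg | left; eapply r_exr; eauto | exact Hps].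
  - eapply derivable_inf; [exact Hg | left; eapply r_E | exact Hps].
    destruct H0 as [H0 H1]; split; simpl; auto; apply Forall2_app; auto.
    clear; induction H; constructor; auto using feqE_refl.
Qed.

Lemma ptree_nested_ind (P : ptree -> Prop) :
  (forall S ps, Forall P ps -> P (PInf S ps)) ->
  (forall psi args S, P (PLink psi args S)) -> forall d, P d.
Proof.
  intros HI HL; fix IH 1; intros [S ps | psi args S]; [| apply HL].
  apply HI; induction ps; constructor; auto.
Qed.

(** Replays a derivation with links under the hypotheses [H], given a derivation for each
    substituted link. The substitution varies from node to node as eigenvariables are renamed; [s0]
    fixes its values on active parameters, which self-links rely on. *)
Lemma derivable_lks_ssubst H d s0 :
  (forall a, eigen a -> ~ In a (lnames H)) -> Forall (good ok) H ->
  valid sg E true false d ->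
  (forall psi args S s, In (psi, args, S) (plinks d) -> good_subst ok s ->
     (forall i, s (NPar Active i) = s0 (NPar Active i)) ->
     wf_seq sg S -> Forall (fun a => tsort sg [] a = Some SOm) args ->
     der (add_hyps H (ssubst s S))) ->
  forall s, good_subst ok s -> (forall i, s (NPar Active i) = s0 (NPar Active i)) ->
  der (add_hyps H (ssubst s (root d))).
Proof.
  intros HH Hg Hv Hl.
  induction d as [S ps IH | psi args S] using ptree_nested_ind; intros s Hs Hs0.
  - apply valid_inf in Hv as (Hwf & HR & Hps).
    destruct HR as [HR | [? _]]; [| discriminate].
    simpl root; destruct (exists_renaming_fresh ok s S Hs) as (s' & Hs' & Hf & Hact & <-).
    apply (derivable_add_hyps H (map (ssubst s') (map root ps))); auto.
    + apply lkE_rule_ssubst; auto; apply Hs'.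
    + destruct (good_ssubst ok s' S Hs' Hwf) as [H1 H2]; split; simpl; auto.
      apply Forall_app; auto.
    + rewrite !Forall_map; rewrite Forall_forall in *; intros p Hp; apply IH; auto.
      * intros psi args S' s'' Hin; apply (Hl psi args); simpl; apply in_flat_map; eauto.
      * intros i; rewrite Hact; auto.
  - simpl in *; destruct Hv as (_ & Hwf & Ha); apply (Hl psi args); auto.
Qed.

End Derivations.

(** * From schemata to induction *)

(** Treats all active parameters alike, so no parameter has to be named. On a sequent whose only
    active parameter is [n] it agrees with [upd (NPar Active n) u]. *)
Definition act_subst (u : term) : fname -> term :=
  fun b => match b with NPar Active _ => u | _ => TFree b end.

Lemma good_act ok u :
  tsort sg [] u = Some SOm -> (forall i, In (NPar Active i) (tnames u) -> ok i) ->
  good_subst ok (act_subst u).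
Proof.
  intros Hu Hk; split; intros [[] j | j]; simpl; auto; intros i [|[]]; discriminate.
Qed.

Lemma assoc_combine_in m ms as_ u :
  assoc_nat m (combine ms as_) = Some u -> In m ms /\ In u as_.
Proof.
  revert as_; induction ms as [| m' ms IH]; intros [| v as_]; simpl; try discriminate.
  destruct (Nat.eqb_spec m m'); [intros [= <-]; auto |].
  intros H; apply IH in H; tauto.
Qed.

Lemma sorted_psub n t ms as_ :
  Forall (fun a => tsort sg [] a = Some SOm) (t :: as_) -> sorted (psub n t ms as_).
Proof.
  intros H [[] i | i]; simpl; auto; inversion_clear H as [| ? ? Ht Has].
  - destruct Nat.eqb; auto.
  - destruct assoc_nat as [u|] eqn:Hu; auto.
    apply assoc_combine_in in Hu; rewrite Forall_forall in Has; apply Has, Hu.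
Qed.

Section SchemaToInduction.

(** The only active parameter of the target derivation; those of all components are renamed to
    it. *)
Variable k : nat.

Let ok := eq k.
Local Notation der := (derivable ok false true (fun _ => True)).

(** One induction inference without internal parameters or side formulas; the instance at [TZero] in
    its antecedent is then cut away. As [k] is the only active parameter of [F], [act_subst] agrees
    there with [upd] and [psub]. *)
Lemma derivable_induction F t :
  good ok F -> tsort sg [] t = Some SOm -> (forall i, In (NPar Active i) (tnames t) -> ok i) ->
  der (Seq [] [fsubst (act_subst TZero) F]) ->
  der (Seq [F] [fsubst (act_subst (TSucc (TFree (NPar Active k)))) F]) ->
  der (Seq [] [fsubst (act_subst t) F]).
Proof.
  intros [HF Hk] Ht Htk H0 HS.
  assert (Hact : forall u, fsubst (psub k u [] []) F = fsubst (act_subst u) F).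
  { intros u; apply fsubst_ext; intros [[] i | i] Hi; simpl; auto.
    rewrite <- (Hk i Hi), Nat.eqb_refl; auto. }
  assert (Hupd : forall u, fsubst (upd (NPar Active k) u) F = fsubst (act_subst u) F).
  { intros u; apply fsubst_ext; intros a Hi; unfold upd.
    destruct fname_eq_dec as [<- | Hne]; auto.
    destruct a as [[] i | i]; auto.
    exfalso; apply Hne; f_equal; apply Hk, Hi. }
  assert (Hgt : good ok (fsubst (act_subst t) F)) by (apply good_fsubst; auto using good_act).
  assert (Hg0 := derivable_good _ _ _ _ _ H0); apply good_seq_cons_r in Hg0 as [Hg0 Hnil].
  apply (derivable_cut _ _ _ _ (fsubst (act_subst TZero) F)).
  - apply (derivable_incl _ _ _ _ _ _ _ _ H0); [apply incl_refl | |].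
    + intros B [<- | []]; simpl; auto.
    + rewrite !good_seq_cons_r; auto.
  - eapply derivable_inf; [| right; split; [reflexivity |] |].
    + rewrite good_seq_cons_l, good_seq_cons_r; auto.
    + rewrite <- !Hact; apply (r_ind sg F k [] [] t [] []); simpl; auto; constructor.
    + rewrite Hupd; auto.
Qed.

(* Internal parameters cannot be quantified, so they are turned into passive
   ones, kept apart from the original passive parameters by parity. *)
Definition passive_encoding (a : fname) : term :=
  match a with
  | NPar Active _ => TFree (NPar Active k)
  | NPar Passive i => TFree (NPar Passive (2 * i))
  | NPar Internal i => TFree (NPar Passive (S (2 * i)))
  | NVar _ => TFree a
  end.

(** Carries [s] over to encoded names: an even passive index stands for a passive parameter, an odd
    one for an internal parameter, and an active name for [n], the component's own active
    parameter. *)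
Definition passive_decoding (s : fname -> term) (n : nat) (a : fname) : term :=
  match a with
  | NPar Active _ => s (NPar Active n)
  | NPar Passive j =>
      s (NPar (if Nat.even j then Passive else Internal) (Nat.div2 j))
  | NPar Internal _ => TFree a
  | NVar _ => s a
  end.

Lemma good_encoding : good_subst ok passive_encoding.
Proof.
  split; intros [[] i | i]; simpl; auto; intros j [|[]]; try discriminate.
  injection H; auto.
Qed.

Lemma good_decoding s n : good_subst ok s -> good_subst ok (passive_decoding s n).
Proof.
  intros [Hs Hk]; split.
  - intros [[] i | i]; simpl; auto; apply Hs.
  - intros [[] i | i] j; simpl; eauto; intros [|[]]; discriminate.
Qed.

Lemma decoding_encoding s n S :
  (forall i, In i (active_params S) -> i = n) ->
  ssubst (passive_decoding s n) (ssubst passive_encoding S) = ssubst s S.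
Proof.
  intros Hn; rewrite ssubst_comp; apply ssubst_ext; intros [[] i | i] Hi; auto.
  - rewrite (Hn i); [reflexivity | apply in_active_params; auto].
  - unfold passive_encoding, tsubst, passive_decoding.
    now rewrite Nat.even_even, Nat.div2_double.
  - unfold passive_encoding, tsubst, passive_decoding.
    now rewrite Nat.even_succ, <- Nat.negb_even, Nat.even_even, Nat.div2_succ_double.
Qed.

Definition is_nonactive (a : fname) : bool :=
  match a with NPar Active _ => false | _ => true end.

Definition closed_form (S : sequent) : form :=
  let A := seq_form (ssubst passive_encoding S) in
  closure (filter is_nonactive (fnames A)) A.

Lemma closed_form_names S a :
  In a (fnames (closed_form S)) -> exists i, a = NPar Active i.
Proof.
  intros Ha; apply fnames_closure in Ha as [Ha Hn]; rewrite filter_In in Hn.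
  destruct a as [[] i | i]; eauto; simpl in Hn; tauto.
Qed.

Lemma active_nonempty S n : In n (active_params S) -> nonempty_seq S.
Proof.
  intros Hn He; apply in_active_params, in_snames in Hn as (A & HA & _).
  destruct S as [[] []]; simpl in *; try discriminate; tauto.
Qed.

Section ClosedForm.

Variables (n : nat) (S : sequent).
Hypotheses (Hn : forall i, In i (active_params S) <-> i = n) (Hwf : wf_seq sg S).

Let A := seq_form (ssubst passive_encoding S).

Let HA : nonempty_seq S.
Proof. apply (active_nonempty S n), Hn; reflexivity. Qed.

Let HAg : good ok A.
Proof.
  apply good_seq_form; [apply nonempty_ssubst, HA |].
  apply good_ssubst; auto using good_encoding.
Qed.

Lemma good_closed_form : good ok (closed_form S).
Proof.
  destruct HAg as [H1 H2]; split; [apply wf_closure, H1 |].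
  intros i Hi; apply fnames_closure in Hi; apply H2, Hi.
Qed.

(** The quantifiers are instantiated by the decoded substitution, which undoes the encoding; the one
    name left unquantified is active and already has the value [s (NPar Active n)]. *)
Lemma closed_form_inst s H :
  good_subst ok s ->
  der (Seq H [fsubst (act_subst (s (NPar Active n))) (closed_form S)]) ->
  der (add_hyps H (ssubst s S)).
Proof.
  intros Hs Hd; assert (Hdec := good_decoding s n Hs).
  apply (derivable_closure_inst _ _ _ _ _ A _ (passive_decoding s n)) in Hd; auto.
  - unfold A in Hd; rewrite <- seq_form_ssubst in Hd by (apply nonempty_ssubst, HA).
    rewrite decoding_encoding in Hd by apply Hn.
    apply derivable_seq_form in Hd; auto using nonempty_ssubst, good_ssubst.
  - apply good_act; [apply Hs | apply Hs].
  - apply HAg.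
  - intros [[] i | i] Hb Hf; auto; exfalso; apply Hf, filter_In; auto.
Qed.

(** The names of [u] and [H] are active, whereas those generalized are not; hence [u] is not
    captured and the eigenvariable conditions hold. *)
Lemma closed_form_intro u H :
  tsort sg [] u = Some SOm -> (forall a, In a (tnames u) -> a = NPar Active k) ->
  (forall a, In a (lnames H) -> exists i, a = NPar Active i) ->
  der (add_hyps H (ssubst (act_subst u) (ssubst passive_encoding S))) ->
  der (Seq H [fsubst (act_subst u) (closed_form S)]).
Proof.
  intros Hu Huk HH Hd; unfold closed_form; fold A; rewrite fsubst_closure.
  - apply derivable_closure.
    + rewrite Forall_forall; intros a Ha; apply filter_In in Ha as [Ha Hna].
      destruct a as [[] i | i]; try discriminate; try exact I.
      (* The encoding produces no internal name, so every generalized name can be an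
         eigenvariable. *)
      exfalso; unfold A, seq_form in Ha.
      assert (He := nonempty_ssubst passive_encoding S HA); unfold nonempty_seq in He.
      change (disj _) with (seq_form (ssubst passive_encoding S)) in Ha.
      rewrite seq_form_ssubst in Ha by apply HA.
      apply fnames_fsubst in Ha as ([[] j | j] & _ & [Ha | []]); discriminate.
    + intros a Ha Hin; apply HH in Hin as (i & ->); apply filter_In in Ha as [_ Ha].
      discriminate.
    + unfold A; rewrite <- seq_form_ssubst by apply nonempty_ssubst, HA.
      apply derivable_seq_form; auto using nonempty_ssubst, good_ssubst.
      apply good_ssubst; [apply good_act; auto |].
      * intros i Hi; apply Huk in Hi; injection Hi; unfold ok; auto.
      * apply good_seq_iff with ok, good_ssubst; auto using good_encoding.
  - intros a Ha; apply filter_In in Ha as [_ Ha]; destruct a as [[] i | i]; auto; discriminate.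
  - intros a b Ha Hin; apply filter_In in Ha as [_ Ha].
    destruct b as [[] j | j]; simpl in Hin; try (destruct Hin as [<- | []]; auto; fail).
    apply Huk in Hin; subst; discriminate.
Qed.

End ClosedForm.

(** Quantified over substitutions because a link inserts arbitrary arguments, and replaying the
    derivation around it substitutes once more. *)
Definition all_instances_derivable (C : component) : Prop :=
  forall s, good_subst ok s -> der (ssubst s (c_es C)).

(** Read off from the root of [c_pi C], since well-sorted substitutions reflect well-formedness. *)
Lemma component_wf C : is_component sg E C -> wf_seq sg (c_es C).
Proof.
  intros (_ & _ & Hv & Hr & _).
  assert (H : wf_seq sg (root (c_pi C))) by (destruct (c_pi C); simpl in *; apply Hv).
  rewrite Hr in H; destruct H as [H1 H2].
  assert (Hs : sorted (upd (NPar Active (c_n C)) TZero)).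
  { apply sorted_over; auto using sorted_id. }
  split; [revert H1 | revert H2]; simpl; rewrite Forall_map; apply Forall_impl;
    intros A; apply wf_fsubst_inv, Hs.
Qed.

(** Composing the link's substitution with [s] gives again an instance of the end-sequent of [D].
    The value at its active parameter is recorded for self-links. *)
Lemma linked_instance D args S s :
  Forall (fun a => tsort sg [] a = Some SOm) args -> link_to D args S -> good_subst ok s ->
  exists s', good_subst ok s' /\ ssubst s S = ssubst s' (c_es D) /\
    forall t as_, args = t :: as_ -> s' (NPar Active (c_n D)) = tsubst s t.
Proof.
  intros Ha (t & as_ & -> & _ & ->) Hs.
  exists (fun a => tsubst s (psub (c_n D) t (c_I D) as_ a)); split; [| split].
  - apply good_comp; auto using sorted_psub.
  - apply ssubst_comp.
  - intros t' as' [= <- <-]; simpl; now rewrite Nat.eqb_refl.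
Qed.

Lemma derivable_add_hyps_weaken H S :
  Forall (good ok) H -> der S -> der (add_hyps H S).
Proof.
  intros HH Hd; assert (Hg := derivable_good _ _ _ _ _ Hd); destruct S as [G D].
  apply (derivable_incl _ _ _ _ _ _ _ _ Hd); auto using incl_refl, incl_appl.
  destruct Hg; split; simpl; auto; apply Forall_app; auto.
Qed.

Lemma component_instances_derivable C :
  is_component sg E C ->
  (forall psi args S, In (psi, args, S) (plinks (c_pi C)) ->
     exists D, link_to D args S /\ all_instances_derivable D) ->
  (forall psi args S, In (psi, args, S) (plinks (c_nu C)) ->
     exists D, link_to D args S /\
       (all_instances_derivable D \/
        D = C /\ exists as_, args = TFree (NPar Active (c_n C)) :: as_)) ->
  all_instances_derivable C.
Proof.
  intros HC Hpi Hnu s Hs; assert (Hwf := component_wf C HC).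
  destruct HC as ([Hn _] & _ & Hvp & Hrp & _ & Hvn & Hrn & _).
  assert (Hg := good_closed_form _ _ Hn Hwf); set (F := closed_form (c_es C)) in *.
  assert (Hrho := good_encoding).
  enough (H : der (add_hyps [] (ssubst s (c_es C)))).
  { unfold add_hyps in H; rewrite app_nil_r in H; destruct (ssubst s (c_es C)); auto. }
  apply (closed_form_inst (c_n C)); auto; apply derivable_induction; auto; try apply Hs.
  - apply (closed_form_intro (c_n C)); auto; simpl; try tauto.
    (* Setting the active parameter to 0 before or after the encoding gives the same sequent, which
       makes [c_pi C] usable here. *)
    replace (ssubst (act_subst TZero) (ssubst passive_encoding (c_es C)))
      with (ssubst passive_encoding (root (c_pi C))).
    + apply derivable_lks_ssubst with (s0 := passive_encoding); auto; simpl; auto.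
      intros psi args S s' Hin Hs' _ _ Ha.
      destruct (Hpi _ _ _ Hin) as (D & Hl & HD).
      destruct (linked_instance D args S s' Ha Hl Hs') as (s'' & Hs'' & -> & _).
      apply derivable_add_hyps_weaken; auto.
    + rewrite Hrp, !ssubst_comp; apply ssubst_ext; intros a Ha.
      unfold upd; destruct fname_eq_dec as [<- | Hne]; auto.
      destruct a as [[] i | i]; auto.
      exfalso; apply Hne; f_equal; symmetry; apply Hn, in_active_params, Ha.
  - apply (closed_form_intro (c_n C)); auto; simpl.
    + intros a [|[]]; auto.
    + rewrite app_nil_r; apply closed_form_names.
    + replace (ssubst (act_subst (TSucc (TFree (NPar Active k))))
                 (ssubst passive_encoding (c_es C)))
        with (ssubst passive_encoding (root (c_nu C))).
      * apply derivable_lks_ssubst with (s0 := passive_encoding); auto.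
        { intros a Ha; simpl; rewrite app_nil_r; intros Hin.
          apply closed_form_names in Hin as (i & ->); exact Ha. }
        intros psi args S s' Hin Hs' Hact _ Ha.
        destruct (Hnu _ _ _ Hin) as (D & Hl & HD).
        destruct (linked_instance D args S s' Ha Hl Hs') as (s'' & Hs'' & -> & Ht).
        destruct HD as [HD | (-> & as_ & ->)].
        { apply derivable_add_hyps_weaken; auto. }
        (* A self-link called at the active parameter: replaying keeps the value [k] there, so the
           link follows from the hypothesis [F]. *)
        apply (closed_form_inst (c_n C)); auto.
        rewrite (Ht _ _ eq_refl); simpl; rewrite Hact; simpl.
        apply derivable_ax with F; simpl; auto.
        { left; transitivity (fsubst TFree F); [apply fsubst_ext | apply fsubst_id].
          intros a Hin'; assert (Hk := proj2 Hg).
          destruct (closed_form_names _ _ Hin') as (i & ->); simpl.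
          apply Hk in Hin' as <-; auto. }
        rewrite good_seq_cons_l, good_seq_cons_r.
        split; [auto | split; [| split; constructor]].
        apply good_fsubst; [apply good_act; simpl; auto | apply Hg].
        intros i [Hi | []]; injection Hi; auto.
      * rewrite Hrn, !ssubst_comp; apply ssubst_ext; intros a Ha.
        unfold upd; destruct fname_eq_dec as [<- | Hne]; auto.
        destruct a as [[] i | i]; auto.
        exfalso; apply Hne; f_equal; symmetry; apply Hn, in_active_params, Ha.
Qed.

Lemma schema_instances_derivable P Psi i C :
  P_schema sg E P Psi -> nth_error Psi i = Some C -> all_instances_derivable C.
Proof.
  intros (_ & _ & Hc & _ & R & _ & _ & HR & _ & Hl); revert C.
  induction i as [i IH] using (well_founded_induction HR); intros C HC.
  destruct (Hl i C HC) as [Hpi Hnu]; apply component_instances_derivable.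
  - rewrite Forall_forall in Hc; apply Hc; eapply nth_error_In; eauto.
  - intros psi args S Hin; apply Hpi in Hin as (j & D & HD & _ & _ & Hij & HL); eauto.
  - intros psi args S Hin; apply Hnu in Hin as (j & D & HD & _ & HL & [[-> H] | [_ Hij]]);
      exists D; split; eauto.
    right; split; auto; congruence.
Qed.

End SchemaToInduction.

Lemma schema_to_induction P Psi S n :
  (forall i, In i (active_params S) <-> i = n) ->
  P_schema sg E P Psi -> schema_es Psi = Some S ->
  exists d, mvLKIE_derivation sg E d /\ root d = S.
Proof.
  intros Hn HP HS.
  destruct Psi as [| C Psi]; [discriminate |]; injection HS as <-.
  (* With [n] as the target's active parameter, this substitution is the identity on the
     end-sequent. *)
  assert (Ht : good_subst (eq n) (act_subst (TFree (NPar Active n)))).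
  { apply good_act; auto; simpl; intros i [[= ->] | []]; auto. }
  destruct (schema_instances_derivable n P _ 0 C HP eq_refl _ Ht) as (d & Hv & Hr & Ha & _).
  exists d; split; [split; auto |].
  - revert Ha; apply Forall_impl; intros S HS i j Hi Hj.
    rewrite <- (HS i), <- (HS j); auto.
  - rewrite Hr; transitivity (ssubst TFree (c_es C)); [apply ssubst_ext | apply ssubst_id].
    intros [[] i | i] Hi; auto.
    apply in_active_params, Hn in Hi as ->; auto.
Qed.

(** * From induction to schemata *)

Definition linkable (Psi : list component) (l : nat * list term * sequent) : Prop :=
  exists D, In D Psi /\ c_sym D = fst (fst l) /\ link_to D (snd (fst l)) (snd l).

Definition self_link (C : component) (l : nat * list term * sequent) : Prop :=
  fst (fst l) = c_sym C /\ link_to C (snd (fst l)) (snd l) /\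
  exists as_, snd (fst l) = TFree (NPar Active (c_n C)) :: as_.

(** Apart from self-links, all links lead to later members of the list, so that positions can serve
    as the order of a schema. *)
Inductive linked_list : list component -> Prop :=
| linked_nil : linked_list []
| linked_cons C Psi :
    linked_list Psi -> is_component sg E C -> ~ In (c_sym C) (map c_sym Psi) ->
    Forall (linkable Psi) (plinks (c_pi C)) ->
    Forall (fun l => linkable Psi l \/ self_link C l) (plinks (c_nu C)) ->
    linked_list (C :: Psi).

Lemma linkable_incl Psi Psi' l : incl Psi Psi' -> linkable Psi l -> linkable Psi' l.
Proof. intros Hi (D & HD & H); exists D; auto. Qed.

Lemma linked_app Psi Psi' :
  linked_list Psi -> linked_list Psi' ->
  (forall C D, In C Psi -> In D Psi' -> c_sym C <> c_sym D) -> linked_list (Psi ++ Psi').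
Proof.
  intros H H'; induction H as [| C Psi H IH HC Hn Hpi Hnu]; simpl; intros Hd; auto.
  constructor; auto.
  - rewrite map_app, in_app_iff; intros [Hin | Hin]; auto.
    apply in_map_iff in Hin as (D & Heq & HD); apply (Hd C D); auto.
  - revert Hpi; apply Forall_impl; intros l; apply linkable_incl, incl_appl, incl_refl.
  - revert Hnu; apply Forall_impl; intros l [Hl | Hl]; auto.
    left; revert Hl; apply linkable_incl, incl_appl, incl_refl.
Qed.

Lemma derivable_mono ok links ind (lk lk' : nat * list term * sequent -> Prop) S :
  (forall l, lk l -> lk' l) -> derivable ok links ind lk S -> derivable ok links ind lk' S.
Proof.
  intros Hi (d & Hv & Hr & Ha & Hl); exists d; repeat split; auto.
  revert Hl; apply Forall_impl, Hi.
Qed.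

Lemma derivable_link ok ind (lk : nat * list term * sequent -> Prop) psi args S :
  lk (psi, args, S) -> Forall (fun a => tsort sg [] a = Some SOm) args -> good_seq ok S ->
  derivable ok true ind lk S.
Proof.
  intros Hl Ha Hg; apply good_seq_iff in Hg as [Hwf Hk].
  exists (PLink psi args S); repeat split; simpl; auto; apply Hwf.
Qed.

Definition active_in (u : term) (i : nat) : Prop := In (NPar Active i) (tnames u).

Definition active_term (u : term) : Prop :=
  tsort sg [] u = Some SOm /\ forall a, In a (tnames u) -> exists i, a = NPar Active i.

(** Uniformity in [u] allows one translation to be used at the active parameter, inside the step of
    an induction component, and at 0 and the successor, for the first component. *)
Definition schematic (Psi : list component) (S : sequent) : Prop :=
  forall u, active_term u ->
    derivable (active_in u) true false (linkable Psi) (ssubst (act_subst u) S).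

Lemma schematic_incl Psi Psi' S : incl Psi Psi' -> schematic Psi S -> schematic Psi' S.
Proof.
  intros Hi H u Hu; apply derivable_mono with (linkable Psi); auto.
  intros l; apply linkable_incl, Hi.
Qed.

Lemma good_act_active u : active_term u -> good_subst (active_in u) (act_subst u).
Proof. intros [Hu _]; apply good_act; auto. Qed.

Lemma renames_fresh_act u S : active_term u -> renames_fresh (act_subst u) S.
Proof.
  intros [_ Hu] a Ha Hn; exists a.
  assert (Hact : forall i, a <> NPar Active i) by (intros i ->; exact Ha).
  repeat split; auto.
  - destruct a as [[] i | i]; auto; now elim (Hact i).
  - intros Hin; apply snames_ssubst in Hin as (b & Hb & Hin).
    destruct b as [[] i | i]; simpl in Hin;
      try (destruct Hin as [<- | []]; auto; fail).
    apply Hu in Hin as (j & ->); now elim (Hact j).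
Qed.

Lemma fsubst_fix s A : (forall a, In a (fnames A) -> s a = TFree a) -> fsubst s A = A.
Proof. intros H; rewrite (fsubst_ext s TFree) by auto; apply fsubst_id. Qed.

Lemma ssubst_fix s S : (forall a, In a (snames S) -> s a = TFree a) -> ssubst s S = S.
Proof. intros H; rewrite (ssubst_ext s TFree) by auto; apply ssubst_id. Qed.

Lemma assoc_combine_map f ms m :
  assoc_nat m (combine ms (map f ms)) = if in_dec Nat.eq_dec m ms then Some (f m) else None.
Proof.
  induction ms as [| m' ms IH]; auto.
  change (combine (m' :: ms) (map f (m' :: ms))) with ((m', f m') :: combine ms (map f ms)).
  simpl assoc_nat; rewrite IH.
  destruct (Nat.eqb_spec m m') as [<- | Hn];
    destruct in_dec as [H1 | H1], in_dec as [H2 | H2]; auto; simpl in *; tauto || firstorder congruence.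
Qed.

(** * The component belonging to one induction inference *)

Section InductionComponent.

Variables (F : form) (n : nat) (ms : list nat) (as_ : list term) (t : term)
  (G D : list form).

Let X := Seq (F :: G)
  (fsubst (upd (NPar Active n) (TSucc (TFree (NPar Active n)))) F :: D).

Hypotheses (HnGD : ~ In (NPar Active n) (lnames G ++ lnames D))
  (Hms : forall m, In m ms -> ~ In (NPar Internal m) (lnames G ++ lnames D))
  (Ht : tsort sg [] t = Some SOm)
  (Has : Forall (fun a => tsort sg [] a = Some SOm) as_)
  (HwfX : wf_seq sg X)
  (HX : forall i j, In i (active_params X) -> In j (active_params X) -> i = j)
  (HnF : In (NPar Active n) (fnames F)).

Let concl := Seq (fsubst (psub n TZero ms as_) F :: G) (fsubst (psub n t ms as_) F :: D).

Let es := Seq (fsubst (act_subst TZero) F :: G) (F :: D).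
(** A component lists exactly the internal parameters of its end-sequent, whereas [ms] may contain
    some that do not occur and miss others. *)
Let ints := nodup Nat.eq_dec (internal_params es).
Let self_args := TFree (NPar Active n) :: map (fun m => TFree (NPar Internal m)) ints.

Variables (Psi : list component) (b : nat).

(** The component exists only once its step is derived, so the self-link is described by its label,
    arguments and conclusion. *)
Let lk_self l := linkable Psi l \/ l = (b, self_args, es).

Let active_F i : In (NPar Active i) (fnames F) -> i = n.
Proof.
  intros Hi; apply HX; apply in_active_params, in_snames; exists F; simpl; auto.
Qed.

Let in_GD A a : In A G \/ In A D -> In a (fnames A) -> In a (lnames G ++ lnames D).
Proof.
  intros HA Ha; apply in_or_app; destruct HA; [left | right]; apply in_flat_map; eauto.
Qed.

(** As [n] occurs in [F], it is the only active parameter of the premise, and the side condition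
    keeps it out of [G] and [D]. *)
Let active_GD A i : In A G \/ In A D -> ~ In (NPar Active i) (fnames A).
Proof.
  intros HA Hi; assert (i = n) as ->.
  { apply HX; apply in_active_params, in_snames.
    - exists A; simpl; tauto.
    - exists F; simpl; auto. }
  eapply HnGD, in_GD; eauto.
Qed.

Let names_F0 a : In a (fnames (fsubst (act_subst TZero) F)) ->
  In a (fnames F) /\ forall i, a <> NPar Active i.
Proof.
  intros Ha; apply fnames_fsubst in Ha as ([[] j | j] & Hj & Ha); simpl in Ha;
    try tauto; destruct Ha as [<- | []]; split; auto; discriminate.
Qed.

Let active_es i : In i (active_params es) <-> i = n.
Proof.
  rewrite in_active_params, in_snames; simpl; split.
  - intros (A & [[<- | HA] | [<- | HA]] & Hi); auto.
    + apply names_F0 in Hi as [Hi _]; auto.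
    + exfalso; eapply active_GD; eauto.
    + exfalso; eapply active_GD; eauto.
  - intros ->; eauto.
Qed.

Let wf_es : wf_seq sg es.
Proof.
  destruct HwfX as [H1 H2]; simpl in *.
  apply Forall_cons_iff in H1 as [HF HG]; apply Forall_cons_iff in H2 as [_ HD].
  split; simpl; constructor; auto.
  apply wf_fsubst; auto; apply (good_act (fun _ => True)); auto.
Qed.

Let es_zero : ssubst (upd (NPar Active n) TZero) es = ssubst (act_subst TZero) es.
Proof.
  apply ssubst_ext; intros a Ha; unfold upd; destruct fname_eq_dec as [<- | Hne]; auto.
  destruct a as [[] i | i]; auto.
  exfalso; apply Hne; f_equal; symmetry; apply active_es, in_active_params, Ha.
Qed.

Let es_succ :
  ssubst (upd (NPar Active n) (TSucc (TFree (NPar Active n)))) es =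
  Seq (fsubst (act_subst TZero) F :: G)
      (fsubst (upd (NPar Active n) (TSucc (TFree (NPar Active n)))) F :: D).
Proof.
  assert (HA : forall A, In A G \/ In A D ->
    fsubst (upd (NPar Active n) (TSucc (TFree (NPar Active n)))) A = A).
  { intros A HA; apply fsubst_fix; intros a Ha; unfold upd; destruct fname_eq_dec; auto.
    subst a; exfalso; eapply active_GD; eauto. }
  unfold ssubst, es; simpl; f_equal; f_equal.
  - apply fsubst_fix; intros a Ha; unfold upd; destruct fname_eq_dec as [<- |]; auto.
    apply names_F0 in Ha as [_ Ha]; now elim (Ha n).
  - rewrite <- (map_id G) at 2; apply map_ext_in; auto.
  - rewrite <- (map_id D) at 2; apply map_ext_in; auto.
Qed.

Let derivable_base :
  derivable (fun _ => False) true false (linkable Psi) (ssubst (upd (NPar Active n) TZero) es).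
Proof.
  rewrite es_zero; apply derivable_ax with (fsubst (act_subst TZero) F).
  - left; rewrite fsubst_comp; apply fsubst_ext; intros [[] i | i] _; auto.
  - left; auto.
  - apply good_ssubst; auto; apply good_act; auto.
Qed.

Let good_es : good_seq (active_in (TFree (NPar Active n))) es.
Proof.
  apply good_seq_iff; split; auto; intros i Hi; apply active_es in Hi as ->; simpl; left; auto.
Qed.

Let derivable_step :
  schematic Psi X ->
  derivable (active_in (TFree (NPar Active n))) true false lk_self
    (ssubst (upd (NPar Active n) (TSucc (TFree (NPar Active n)))) es).
Proof.
  intros HS; assert (Hu : active_term (TFree (NPar Active n))).
  { split; auto; simpl; intros a [<- | []]; eauto. }
  (* Since [n] is the only active parameter of [X], the translated premise at [n] is [X] itself. *)
  specialize (HS _ Hu); rewrite ssubst_fix in HS.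
  2: { intros [[] i | i] Hi; auto; simpl; do 2 f_equal; apply HX; [| apply in_active_params, Hi].
       apply in_active_params, in_snames; exists F; simpl; auto. }
  apply derivable_mono with (lk' := lk_self) in HS; [| unfold lk_self; auto].
  assert (He : derivable (active_in (TFree (NPar Active n))) true false lk_self es).
  { apply (derivable_link _ _ _ b self_args); auto; [right; auto |].
    constructor; auto; apply Forall_map, Forall_forall; auto. }
  assert (HXg := derivable_good _ _ _ _ _ HS); rewrite es_succ.
  apply good_seq_cons_l in HXg as [HFg HXg].
  apply good_seq_cons_l in good_es as [H0g _].
  assert (Hg : good_seq (active_in (TFree (NPar Active n))) (ssubst
     (upd (NPar Active n) (TSucc (TFree (NPar Active n)))) es)).
  { rewrite es_succ; apply good_seq_cons_l; auto. }
  rewrite es_succ in Hg; apply (derivable_cut _ _ _ _ F).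
  - apply (derivable_incl _ _ _ _ _ _ _ _ He); auto using incl_refl.
    + intros B [<- | HB]; simpl; auto.
    + apply good_seq_cons_r; auto.
  - apply (derivable_incl _ _ _ _ _ _ _ _ HS); auto using incl_refl.
    + intros B [<- | HB]; simpl; auto.
    + apply good_seq_cons_l; auto.
Qed.

(** Arguments of the link: parameters in [ms] receive their terms from [as_], the remaining ones are
    passed on unchanged. *)
Let arg (u : term) (m : nat) : term :=
  match assoc_nat m (combine ms as_) with
  | Some a => tsubst (act_subst u) a
  | None => TFree (NPar Internal m)
  end.

(** The conclusion is the instance of [es] at [t] and [as_]: neither [n] nor the parameters in [ms]
    occur in [G] and [D], so these are left alone. *)
Let concl_link u :
  ssubst (act_subst u) concl =
  ssubst (psub n (tsubst (act_subst u) t) ints (map (arg u) ints)) es.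
Proof.
  assert (HI : forall m A, In A (ant es) \/ In A (suc es) -> In (NPar Internal m) (fnames A) ->
    psub n (tsubst (act_subst u) t) ints (map (arg u) ints) (NPar Internal m) = arg u m).
  { intros m A HA Hm; simpl; rewrite assoc_combine_map; destruct in_dec as [H | H]; auto.
    exfalso; apply H, nodup_In, in_internal_params, in_snames; eauto. }
  assert (Hside : forall A, In A G \/ In A D -> fsubst (act_subst u) A =
    fsubst (psub n (tsubst (act_subst u) t) ints (map (arg u) ints)) A).
  { intros A HA; apply fsubst_ext; intros [[] i | i] Hi; auto.
    - exfalso; eapply active_GD; eauto.
    - rewrite (HI i A); simpl; auto; [| tauto].
      unfold arg; destruct assoc_nat as [a |] eqn:Hi'; auto.
      apply assoc_combine_in in Hi' as [Hi' _].
      exfalso; eapply Hms, in_GD; eauto. }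
  unfold ssubst, concl; simpl; f_equal; f_equal.
  - rewrite !fsubst_comp; apply fsubst_ext; intros [[] i | i] Hi; auto.
    + simpl; rewrite (active_F i Hi), Nat.eqb_refl; auto.
    + transitivity (arg u i).
      * unfold arg; simpl; destruct assoc_nat; auto.
      * symmetry; apply (HI i F); simpl; auto.
  - apply map_ext_in; auto.
  - rewrite fsubst_comp; apply fsubst_ext; intros [[] i | i] Hi; auto.
    + simpl; rewrite (active_F i Hi), Nat.eqb_refl; auto.
    + rewrite (HI i F); simpl; auto.
      unfold arg; destruct assoc_nat; auto.
  - apply map_ext_in; auto.
Qed.

Lemma exists_induction_component :
  wf_seq sg concl -> linked_list Psi -> ~ In b (map c_sym Psi) -> schematic Psi X ->
  exists C, c_sym C = b /\ linked_list (C :: Psi) /\ schematic (C :: Psi) concl.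
Proof.
  intros Hwf Hl Hb HS.
  destruct derivable_base as (dp & Hvp & Hrp & Hap & Hlp).
  destruct (derivable_step HS) as (dn & Hvn & Hrn & Han & Hln).
  exists (Comp b n ints es dp dn); split; [auto | split].
  - constructor; auto.
    + split; [split; simpl; auto |].
      { intros i; unfold ints; rewrite nodup_In; reflexivity. }
      split; [apply NoDup_nodup |]; repeat split; simpl; auto.
      * revert Hap; apply Forall_impl; intros S HSa.
        destruct (active_params S) as [| i l]; auto; destruct (HSa i); simpl; auto.
      * revert Han; apply Forall_impl; intros S HSa i Hi; apply HSa in Hi as [Hi | []].
        injection Hi; auto.
    + revert Hln; apply Forall_impl; intros l [H | ->]; auto; right.
      split; [auto | split; simpl; [| unfold self_args; eauto]].
      eexists _, _; split; [reflexivity | split; [apply length_map |]]; simpl.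
      symmetry; apply ssubst_fix; intros [[] i | i] Hi; auto.
      * apply in_active_params, active_es in Hi as ->; simpl; now rewrite Nat.eqb_refl.
      * simpl; rewrite assoc_combine_map; now destruct in_dec.
  - intros u Hu.
    apply (derivable_link _ _ _ b (tsubst (act_subst u) t :: map (arg u) ints)).
    + eexists; split; [left; reflexivity | split; [reflexivity |]].
      eexists _, _; split; [reflexivity | split; [apply length_map |]]; apply concl_link.
    + assert (Hs : sorted (act_subst u)) by apply good_act_active, Hu.
      constructor; [rewrite tsort_tsubst; auto |].
      apply Forall_map, Forall_forall; intros m _; unfold arg.
      destruct assoc_nat as [a |] eqn:Ha; auto.
      apply assoc_combine_in in Ha as [_ Ha]; rewrite tsort_tsubst by auto.
      rewrite Forall_forall in Has; auto.
    + apply good_ssubst; auto using good_act_active.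
Qed.

End InductionComponent.

(** * Translation of whole derivations *)

Definition one_active (S : sequent) : Prop :=
  forall i j, In i (active_params S) -> In j (active_params S) -> i = j.

(** Proof symbols are taken from the interval between [b] and [e]; successive premises get
    consecutive intervals, so their lists can be appended. *)
Lemma induction_to_linked_list d :
  valid sg E false true d -> Forall one_active (seqs d) -> forall b,
  exists e Psi, linked_list Psi /\ (forall D, In D Psi -> b <= c_sym D < e) /\
    b <= e /\ schematic Psi (root d).
Proof.
  induction d as [S ps IH | psi args S] using ptree_nested_ind; intros Hv Ha b.
  2: destruct Hv; discriminate.
  apply valid_inf in Hv as (Hwf & HR & Hps); simpl in Ha; inversion_clear Ha as [| ? ? _ Ha'].
  assert (Hall : forall b, exists e Psi, linked_list Psi /\
    (forall D, In D Psi -> b <= c_sym D < e) /\ b <= e /\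
    Forall (schematic Psi) (map root ps)).
  { clear HR b; induction ps as [| p ps IHps]; intros b.
    - exists b, []; split; [constructor | split; [intros D [] | simpl; auto]].
    - simpl in Ha'; apply Forall_app in Ha' as [Hap Haps].
      inversion_clear IH as [| ? ? IHp IHps']; inversion_clear Hps as [| ? ? Hp Hps'].
      destruct (IHp Hp Hap b) as (e & Psi & Hl & Hb & Hle & HS).
      destruct (IHps IHps' Hps' Haps e) as (e' & Psi' & Hl' & Hb' & Hle' & HS').
      exists e', (Psi ++ Psi'); split; [| split; [| split]].
      + apply linked_app; auto; intros C D HC HD Heq.
        specialize (Hb C HC); specialize (Hb' D HD); lia.
      + intros D HD; apply in_app_or in HD as [HD | HD];
          [specialize (Hb D HD) | specialize (Hb' D HD)]; lia.
      + lia.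
      + simpl; constructor; [revert HS; apply schematic_incl, incl_appl, incl_refl |].
        revert HS'; apply Forall_impl; intros T.
        apply schematic_incl, incl_appr, incl_refl. }
  destruct HR as [HR | [_ HR]].
  - destruct (Hall b) as (e & Psi & Hl & Hb & Hle & HS).
    exists e, Psi; do 3 (split; [auto |]).
    intros u Hu; apply derivable_inf with (map (ssubst (act_subst u)) (map root ps)).
    + apply good_ssubst; auto using good_act_active.
    + left; apply lkE_rule_ssubst; auto using renames_fresh_act.
      apply good_act_active, Hu.
    + apply Forall_map; revert HS; apply Forall_impl; intros T HT; apply HT, Hu.
  (* The symbol [b] is reserved for the component of this inference. *)
  - destruct (Hall (Datatypes.S b)) as (e & Psi & Hl & Hb & Hle & HS).
    assert (HwfX : Forall (wf_seq sg) (map root ps)).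
    { apply Forall_map; revert Hps; apply Forall_impl; intros [] Hp; simpl in Hp; simpl; tauto. }
    assert (HaX : Forall one_active (map root ps)).
    { apply Forall_map, Forall_forall; intros p Hp; rewrite Forall_forall in Ha'.
      apply Ha', in_flat_map; exists p; split; auto; destruct p; simpl; auto. }
    clear IH Hps Ha' Hall; simpl root.
    inversion HR as [F n ms as_ t G D Hnd Hlen HnGD Hms Ht Has Hprem Hconcl]; subst S.
    rewrite <- Hprem in *.
    apply Forall_inv in HS; apply Forall_inv in HwfX; apply Forall_inv in HaX.
    (* The end-sequent of a component must contain its active parameter, so one is built only if [n]
       occurs in [F]. *)
    destruct (in_dec fname_eq_dec (NPar Active n) (fnames F)) as [HnF | HnF].
    + assert (Hsym : ~ In b (map c_sym Psi)).
      { intros Hin; apply in_map_iff in Hin as (C & Heq & HC); specialize (Hb C HC); lia. }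
      destruct (exists_induction_component F n ms as_ t G D HnGD Hms Ht Has HwfX HaX HnF
        Psi b Hwf Hl Hsym HS) as (C & HC & HlC & HSC).
      exists e, (C :: Psi); split; [auto | split; [| split; [lia | auto]]].
      intros C' [<- | HC']; [lia | specialize (Hb C' HC'); lia].
    + exists e, Psi; split; [auto | split; [| split; [lia |]]].
      { intros C HC; specialize (Hb C HC); lia. }
      intros u Hu; apply derivable_ax with
        (fsubst (act_subst u) (fsubst (psub n TZero ms as_) F)); simpl; auto.
      (* Without [n] in [F], replacing it by 0 or by [t] gives the same formula. *)
      * left; f_equal; apply fsubst_ext; intros [[] i | i] Hi; auto.
        simpl; destruct (Nat.eqb_spec i n); congruence.
      * apply (good_ssubst _ _ _ (good_act_active u Hu) Hwf).
Qed.

(** * Linked lists as schemata *)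

Lemma linked_list_nth Psi i C :
  linked_list Psi -> nth_error Psi i = Some C ->
  is_component sg E C /\
  (forall l, In l (plinks (c_pi C)) -> exists j D, i < j /\ nth_error Psi j = Some D /\
     c_sym D = fst (fst l) /\ link_to D (snd (fst l)) (snd l)) /\
  (forall l, In l (plinks (c_nu C)) -> self_link C l \/
     exists j D, i < j /\ nth_error Psi j = Some D /\
       c_sym D = fst (fst l) /\ link_to D (snd (fst l)) (snd l)).
Proof.
  intros H; revert i; induction H as [| C' Psi H IH HC Hn Hpi Hnu]; intros [| i]; try discriminate.
  - intros [= ->]; rewrite Forall_forall in Hpi, Hnu.
    assert (HL : forall l, linkable Psi l -> exists j D, 0 < j /\ nth_error (C :: Psi) j = Some D /\
     c_sym D = fst (fst l) /\ link_to D (snd (fst l)) (snd l)).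
    { intros l (D & HD & HL); apply In_nth_error in HD as (j & HD).
      exists (S j), D; split; [lia | auto]. }
    split; [auto | split; auto].
    intros l Hl; destruct (Hnu l Hl); auto.
  - intros Hi; simpl in Hi; destruct (IH i Hi) as (Hc & Hp & Hv); split; [auto | split].
    + intros l Hl; destruct (Hp l Hl) as (j & D & Hj & HD); exists (S j), D; split; [lia | auto].
    + intros l Hl; destruct (Hv l Hl) as [| (j & D & Hj & HD)]; auto.
      right; exists (S j), D; split; [lia | auto].
Qed.

Lemma linked_list_NoDup Psi : linked_list Psi -> NoDup (map c_sym Psi).
Proof. induction 1; simpl; constructor; auto. Qed.

Lemma NoDup_map_nth {X Y} (f : X -> Y) l i j x y :
  NoDup (map f l) -> nth_error l i = Some x -> nth_error l j = Some y -> f x = f y -> i = j.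
Proof.
  intros Hd Hi Hj Hf; rewrite NoDup_nth_error in Hd; apply Hd.
  - rewrite length_map; apply nth_error_Some; congruence.
  - rewrite !nth_error_map, Hi, Hj; simpl; congruence.
Qed.

(** A link's substitution fixes passive parameters, so each link keeps those of its target; this is
    the condition in [prec]. *)
Lemma link_to_passive D args S p :
  link_to D args S -> In p (passive_params (c_es D)) -> In p (passive_params S).
Proof.
  intros (t & as_ & _ & _ & ->) Hp; apply in_passive_params in Hp.
  apply in_passive_params, snames_ssubst; exists (NPar Passive p); simpl; auto.
Qed.

Lemma linked_list_schema Psi :
  Psi <> [] -> linked_list Psi -> exists P, P_schema sg E P Psi.
Proof.
  intros Hne Hl; assert (Hd := linked_list_NoDup Psi Hl).
  exists (flat_map passive_params (flat_map comp_seqs Psi)).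
  split; [auto | split; [auto | split; [| split]]].
  - apply Forall_forall; intros C HC; apply In_nth_error in HC as (i & HC).
    apply (linked_list_nth Psi i C Hl HC).
  - apply Forall_forall; intros C HC; apply Forall_forall; intros S HS p Hp.
    apply in_flat_map; exists S; split; auto; apply in_flat_map; eauto.
  (* The order is that of positions, bounded by the length because related positions must hold
     components. *)
  - exists (fun i j => i < j < length Psi); split; [| split; [| split; [| split]]].
    + intros i j [Hij Hj].
      destruct (nth_error Psi i) as [Ci |] eqn:Hi; [| apply nth_error_None in Hi; lia].
      destruct (nth_error Psi j) as [Cj |] eqn:Hj'; [| apply nth_error_None in Hj'; lia].
      exists Ci, Cj; split; [auto | split; [auto | split; [lia |]]].
      split.
      { intros ->; assert (i = j) by (eapply NoDup_map_nth; eauto); lia. }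
      intros psi args S Hin -> p.
      destruct (linked_list_nth Psi i Ci Hl Hi) as (_ & Hp & Hv).
      (* [prec] speaks of symbols; as these are distinct, a link labelled with the symbol of [Cj]
         has [Cj] itself as its target. *)
      assert (HL : forall k D, nth_error Psi k = Some D -> c_sym D = c_sym Cj ->
        link_to D args S -> In p (passive_params (c_es Cj)) -> In p (passive_params S)).
      { intros k D HD Heq HL.
        assert (k = j) as -> by (eapply NoDup_map_nth; eauto).
        assert (D = Cj) as -> by congruence; eapply link_to_passive; eauto. }
      apply in_app_or in Hin as [Hin | Hin].
      * destruct (Hp _ Hin) as (k & D & _ & HD & Heq & HL'); eauto.
      * destruct (Hv _ Hin) as [(Heq & HL' & _) | (k & D & _ & HD & Heq & HL')]; eauto.
    + lia.
    (* Each link to another component shortens the distance to the end of the list. *)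
    + apply (well_founded_lt_compat _ (fun i => length Psi - i)); intros; lia.
    + lia.
    + intros i C HC; destruct (linked_list_nth Psi i C Hl HC) as (_ & Hp & Hv).
      assert (Hlen : forall j D, nth_error Psi j = Some D -> j < length Psi).
      { intros j D HD; apply nth_error_Some; congruence. }
      split; intros psi args S Hin.
      * destruct (Hp _ Hin) as (j & D & Hj & HD & Heq & HL).
        exists j, D; do 2 (split; [auto |]); split; [lia | split; [split; eauto | auto]].
      * destruct (Hv _ Hin) as [(Heq & HL & Has) | (j & D & Hj & HD & Heq & HL)].
        -- exists i, C; simpl in *; auto 8.
        -- exists j, D; do 3 (split; [auto |]); right; split; [lia | split; eauto].
Qed.

Lemma induction_to_schema S n d :
  (forall i, In i (active_params S) <-> i = n) ->
  mvLKIE_derivation sg E d -> root d = S ->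
  exists P Psi, P_schema sg E P Psi /\ schema_es Psi = Some S.
Proof.
  intros Hn [Hv Ha] Hr.
  (* Symbols start at 1, since 0 labels the first component. *)
  destruct (induction_to_linked_list d Hv Ha 1) as (e & Psi & Hl & Hb & _ & HS).
  rewrite Hr in HS.
  assert (Hupd : forall u, ssubst (act_subst u) S = ssubst (upd (NPar Active n) u) S).
  { intros u; apply ssubst_ext; intros a Hin; unfold upd.
    destruct fname_eq_dec as [<- | Hne]; auto; destruct a as [[] i | i]; auto.
    exfalso; apply Hne; f_equal; symmetry; apply Hn, in_active_params, Hin. }
  destruct (HS TZero) as (dp & Hvp & Hrp & Hap & Hlp); [split; simpl; auto; tauto |].
  destruct (HS (TSucc (TFree (NPar Active n)))) as (dn & Hvn & Hrn & Han & Hln).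
  { split; auto; simpl; intros a [<- | []]; eauto. }
  set (C := Comp 0 n (nodup Nat.eq_dec (internal_params S)) S dp dn).
  assert (HC : linked_list (C :: Psi)).
  { constructor; auto.
    - split; [split; simpl; auto |].
      { intros i; rewrite nodup_In; reflexivity. }
      unfold mvLKS_derivation; simpl; rewrite <- !Hupd.
      split; [apply NoDup_nodup |]; repeat split; auto.
      + revert Hap; apply Forall_impl; intros T HT.
        destruct (active_params T) as [| i l]; auto; destruct (HT i); simpl; auto.
      + revert Han; apply Forall_impl; intros T HT i Hi; apply HT in Hi as [Hi | []].
        injection Hi; auto.
    - intros Hin; apply in_map_iff in Hin as (D & Heq & HD).
      specialize (Hb D HD); simpl in Heq; lia.
    - revert Hln; apply Forall_impl; auto. }
  destruct (linked_list_schema (C :: Psi)) as (P & HP); auto; [discriminate |].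
  exists P, (C :: Psi); auto.
Qed.

End Calculi.

Theorem mainTheorem9 :
  forall (sg : signature) (E : rules),
    wf_rules sg E -> primrec_system E -> convergent E ->
    forall (S : sequent) (n : nat),
      (forall i, In i (active_params S) <-> i = n) ->
      ((exists (P : list nat) (Psi : list component),
          P_schema sg E P Psi /\ schema_es Psi = Some S)
       <->
       (exists d : ptree, mvLKIE_derivation sg E d /\ root d = S)).
Proof.
  intros sg E _ _ _ S n Hn; split.
  - intros (P & Psi & HP & HS); eapply schema_to_induction; eauto.
  - intros (d & Hd & HS); eapply induction_to_schema; eauto.
Qed.
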